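(* Suppose $0<q<p<\infty$ and $p>1$, and define $r$ by $\frac1r=\frac1q-\frac1p$. If $b$ is a normal form parameter and $$C_0=\bigg(\int_0^\infty(p'b(x))^{r/p'}(qx)^{r/p}\,dx\bigg)^{1/r},$$ then $\frac qrC_0\le N_{p,q}(b)\le(p')^{1/q}C_0$.
   Context: $L^+$ is the set of Lebesgue measurable functions $(0,\infty)\to[0,\infty]$ and $\|\cdot\|_p$ is the usual $L^p$ (quasi-)norm for Lebesgue measure on $(0,\infty)$; $p'$ denotes the conjugate exponent, $\frac1p+\frac1{p'}=1$. A normal form parameter is a non-increasing function $b:(0,\infty)\to[0,\infty]$. Put $H_bf(x)=\int_0^{b(x)}f(t)\,dt$ for $f\in L^+$, and let $N_{p,q}(b)\in[0,\infty]$ be the smallest $C$ such that $\|H_bf\|_q\le C\|f\|_p$ for all $f\in L^+$ with $\|f\|_p<\infty$. *)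

(* Defs.v *)
From HB Require Import structures.
From mathcomp Require Import all_boot all_order all_algebra.
From mathcomp Require Import all_classical all_reals all_analysis.
From mathcomp Require Import measurable_realfun.

Set Implicit Arguments.
Unset Strict Implicit.
Unset Printing Implicit Defensive.

Import Order.TTheory GRing.Theory Num.Theory.
Import numFieldNormedType.Exports.

Local Open Scope classical_set_scope.
Local Open Scope ring_scope.
Local Open Scope ereal_scope.

(* The carrier R with the sigma-algebra of Lebesgue (not only Borel) measurable
   sets, that is, the domain of completed_lebesgue_measure. *)
Notation lebesgueType R := (caratheodory_type (wlength (@idfun R))^*%mu).

Section normal_form.
Context {R : realType}.

Local Notation mu := (@completed_lebesgue_measure R).

Definition halfline : set R := `]0%R, +oo[.

(* Functions on (0, +oo) are total functions on R; their values outside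
   (0, +oo) are never used. *)
Definition Lplus : set (R -> \bar R) :=
  [set f : R -> \bar R |
    measurable_fun (halfline : set (lebesgueType R)) f /\
    forall x, halfline x -> 0 <= f x].

Definition pnorm (p : R) (f : R -> \bar R) : \bar R :=
  'N[mu]_p%:E [f \_ halfline].

Definition normal_form_parameter (b : R -> \bar R) : Prop :=
  (forall x, halfline x -> 0 <= b x) /\
  (forall x y, halfline x -> halfline y -> (x <= y)%R -> b y <= b x).

Definition hardy (b f : R -> \bar R) (x : R) : \bar R :=
  \int[mu]_(t in [set t | (0 < t)%R /\ t%:E < b x]) f t.

Definition hardy_bound (p q : R) (b : R -> \bar R) : set (\bar R) :=
  [set C | 0 <= C /\ forall f, Lplus f -> pnorm p f < +oo ->
             pnorm q (hardy b f) <= C * pnorm p f].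

Definition hardy_norm (p q : R) (b : R -> \bar R) : \bar R :=
  ereal_inf (hardy_bound p q b).

(* The infimum is attained: hardy_norm is the smallest constant. *)
Lemma hardy_norm_bound (p q : R) (b : R -> \bar R) :
  (0 < p)%R -> (0 < q)%R -> hardy_bound p q b (hardy_norm p q b).
Proof.
move=> p0 q0; split; first by apply: le_ereal_inf_tmp => C [].
move=> f Lf fp; have : 0 <= pnorm p f by exact: Lnorm_ge0.
rewrite le_eqVlt => /predU1P[/esym f0|f0]; last first.
  have fin_f : pnorm p f \is a fin_num by rewrite ge0_fin_numE// ltW.
  have r0 : (0 < fine (pnorm p f))%R by rewrite fine_gt0// f0.
  rewrite -(fineK fin_f) -lee_pdivrMr//; apply: le_ereal_inf_tmp => C [_ hC].
  by rewrite lee_pdivrMr// fineK//; exact: hC.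
have [mf f_ge0] := Lf.
have mH : measurable (halfline : set (lebesgueType R)).
  by apply: sub_caratheodory; exact: (measurable_itv `]0%R, +oo[).
have aef : (f \_ halfline : lebesgueType R -> \bar R) = \0 %[ae mu].
  apply: (@Lnorm_eq0_eq0 _ _ _ mu _ p%:E) => //.
  exact/(measurable_restrictT _ _).1.
have H0 x : hardy b f x = 0.
  rewrite /hardy; set D : set R := [set t | _].
  have DH : D `<=` halfline.
    by move=> t [t0 _]; rewrite /halfline/= in_itv/= t0.
  have mD : measurable (D : set (lebesgueType R)).
    apply: sub_caratheodory; case bx : (b x) => [c| |].
    - rewrite (_ : D = `]0%R, c[%classic); first exact: measurable_itv.
      apply/seteqP; rewrite /D bx; split => t /=; rewrite in_itv/= lte_fin.
        by move=> [-> ->].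
      by move=> /andP.
    - rewrite (_ : D = halfline); first exact: (measurable_itv `]0%R, +oo[).
      apply/seteqP; rewrite /D /halfline bx; split => t /=;
        rewrite in_itv/= ?ltry andbT; last by [].
      by case.
    - rewrite (_ : D = set0); first exact: measurable0.
      by apply/seteqP; rewrite /D bx; split => t //= -[].
  rewrite -[RHS](integral0 mu D); apply: ae_eq_integral => //.
    exact: measurable_funS mf.
  apply: filterS aef => t /= /(_ I) + /DH Ht.
  by rewrite patchE mem_set.
rewrite f0 mule0 /pnorm (_ : _ \_ _ = cst 0) ?Lnorm0//.
  by rewrite eqe gt_eqF.
by apply/funext => x; rewrite patchE H0 if_same.
Qed.

End normal_form.

(* Main.v *)
(* Upper bound.  The integral of f over (0, z) is at most z K(z), where K(y) is
   the supremum of the averages of f over (0, z) with z >= y.  This K is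
   non-increasing and satisfies the weak-type estimate
   l |{K > l}| <= int_{K > l} f, so Doob's argument gives |K|_p <= p' |f|_p.
   Monotonicity of K yields (H_b f)(x)^q <= int_0^{b(x)} q t^(q-1) K(t)^q dt;
   Tonelli's theorem turns the integral of the right-hand side into
   int q t^(q-1) w(t) K(t)^q dt with w(t) = |{b > t}|, and Hoelder's inequality
   with exponents p/q and r/q, followed by the layer-cake formula
   int c t^(c-1) w^s dt = int s x^(s-1) b^c dx, gives the constant.

   Lower bound.  After truncating b so that C_0 is finite, test on
   f = w^(r/(pq)) t^((r/p'-1)/p): since w(t) >= x for t < b(x), H_b f(x) is
   bounded below by a constant multiple of x^(r/(pq)) b(x)^(r/(p'q)). *)

Require Import Defs.
From mathcomp Require Import all_boot all_order all_algebra.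
From mathcomp Require Import all_classical all_reals all_analysis.
From mathcomp Require Import measurable_realfun.
From mathcomp Require Import ring lra.
Import Order.TTheory GRing.Theory Num.Theory.
Import numFieldNormedType.Exports.
Local Open Scope classical_set_scope.
Local Open Scope ring_scope.
Local Open Scope ereal_scope.

(** * Lebesgue measurability on the half-line *)

(** Spelled exactly like the integration domain of [hardy], so that [hardyE] holds by computation.
    The endpoint is an extended real: [segment0 +oo] is the whole half-line. *)
Definition segment0 {R : realType} (g : \bar R) : set R :=
  [set t | (0 < t)%R /\ t%:E < g].

(** For positive x and t, membership of t in [segment0 (g x)] and of x in [superlevel g t] are the
    same condition. This is the exchange behind each use of Tonelli's theorem. *)
Definition superlevel {R : realType} (g : R -> \bar R) (t : R) : set R :=
  [set x | (0 < x)%R /\ t%:E < g x].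

Section lebesgue_halfline.
Context {R : realType}.
Local Notation mu := (@completed_lebesgue_measure R).
Local Notation H := (halfline : set (lebesgueType R)).

Lemma halflineE (x : R) : halfline x = (0 < x)%R :> Prop.
Proof. by rewrite /halfline/= in_itv/= andbT. Qed.

Lemma measurable_interval (A : set R) : is_interval A ->
  measurable (A : set (lebesgueType R)).
Proof. by move=> iA; apply: sub_caratheodory; exact: is_interval_measurable. Qed.

Lemma measurable_halfline : measurable H.
Proof. by apply: measurable_interval; exact: interval_is_interval. Qed.

Lemma segment0_interval (g : \bar R) : is_interval (segment0 g).
Proof.
move=> x y [x0 xg] [y0 yg] z /andP[xz zy]; split; first exact: lt_le_trans xz.
by apply: le_lt_trans yg; rewrite lee_fin.
Qed.

Lemma measurable_segment0 (g : \bar R) :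
  measurable (segment0 g : set (lebesgueType R)).
Proof. exact/measurable_interval/segment0_interval. Qed.

Lemma segment0_sub (g : \bar R) : segment0 g `<=` halfline.
Proof. by move=> x [x0 _]; rewrite halflineE. Qed.

Lemma lebesgue_measurable_funT d (T : measurableType d) (f : R -> T) :
  measurable_fun [set: measurableTypeR R] f ->
  measurable_fun [set: lebesgueType R] f.
Proof. by move=> mf _ Y mY; apply: sub_caratheodory; exact: mf. Qed.

(** Lebesgue measure on Borel sets is the pushforward of its completion under the identity. This
    opens the way to results on Borel functions such as the fundamental theorem of calculus. *)
Lemma integral_completed (D : set R) (f : R -> \bar R) :
  measurable (D : set (measurableTypeR R)) ->
  measurable_fun (D : set (measurableTypeR R)) f -> (forall x, D x -> 0 <= f x) ->
  \int[mu]_(x in D) f x = \int[lebesgue_measure]_(x in D) f x.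
Proof.
move=> mD mf f0.
have mid : measurable_fun [set: lebesgueType R] (idfun : _ -> measurableTypeR R).
  by move=> _ Y mY; rewrite setTI; apply: sub_caratheodory; exact: mY.
rewrite (_ : lebesgue_measure = pushforward mu (idfun : lebesgueType R -> measurableTypeR R)).
  rewrite (ge0_integral_pushforward mid) // => y; rewrite inE; exact: f0.
by [].
Qed.

(** The part of {g > r} in the half-line is an interval. Many measurability claims below reduce to
    monotonicity in this way. *)
Lemma measurable_nonincreasing (g : R -> \bar R) :
  (forall x y, (0 < x)%R -> (x <= y)%R -> g y <= g x) ->
  measurable_fun H g.
Proof.
move=> g_ni; apply: (measurability (@ErealGenOInfty.G R)) => [|/= _ [_] [r ->] <-].
  exact: ErealGenOInfty.measurableE.
apply: measurable_interval => x y/=.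
rewrite !in_itv/= !andbT !halflineE => -[x0 fx] [y0 fy] z /andP[xz zy].
have z0 := lt_le_trans x0 xz.
by rewrite halflineE in_itv/= andbT; split => //; exact: lt_le_trans (g_ni _ _ z0 zy).
Qed.
End lebesgue_halfline.

(** * Integrals of power functions *)

Section powers.
Context {R : realType}.
Local Notation mu := (@completed_lebesgue_measure R).
Local Notation H := (halfline : set (lebesgueType R)).

(** The left end stays positive because t^(s-1) is unbounded near 0 when s < 1. *)
Lemma integral_powR_itv (s a z : R) : (0 <= s)%R -> (0 < a)%R -> (a < z)%R ->
  \int[mu]_(t in `[a, z]) (s * t `^ (s - 1))%:E = (z `^ s - a `^ s)%:E.
Proof.
move=> s0 a0 az.
have cP (c : R) x : (0 < x)%R -> {for x, continuous (@powR R ^~ c)}.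
  move=> x0; apply: differentiable_continuous; apply/derivable1_diffP.
  by apply: derivable_powR; rewrite in_itv/= x0.
have cF : {within `[a, z], continuous (fun t : R => s * t `^ (s - 1))%R}.
  apply: continuous_in_subspaceT => x; rewrite inE/= in_itv/= => /andP[ax _].
  by apply: cvgMr; apply: cP; exact: lt_le_trans ax.
rewrite integral_completed//.
- rewrite (@continuous_FTC2 _ _ (@powR R ^~ s))//.
  + split.
    * move=> x /[!in_itv]/= /andP[ax _]; apply: derivable_powR.
      by rewrite in_itv/= (lt_trans a0 ax).
    * exact/cvg_at_right_filter/cP.
    * by apply: cvg_at_left_filter; apply: cP; exact: lt_trans az.
  + move=> x /[!in_itv]/= /andP[ax _]; rewrite powR_derive1 //.
    by rewrite in_itv/= (lt_trans a0 ax).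
- by apply/measurable_EFinP; apply: subspace_continuous_measurable_fun.
- by move=> x _; rewrite lee_fin mulr_ge0 ?powR_ge0 // ltW.
Qed.

Lemma measurable_powR_density (s c : R) :
  measurable_fun [set: measurableTypeR R] (fun t : R => (s * t `^ c)%:E).
Proof.
apply/measurable_EFinP; apply: measurable_funM; first exact: measurable_cst.
exact: measurable_powR.
Qed.

(** Powers become integrals over (0, g), the form in which Tonelli's theorem can act. For finite g
    the left end of a closed interval tends to 0; for g = +oo every finite level is exceeded. *)
Lemma integral_powR_segment0 (s : R) (g : \bar R) : (0 < s)%R -> 0 <= g ->
  \int[mu]_(t in segment0 g) (s * t `^ (s - 1))%:E = g `^ s.
Proof.
move=> s0; have f0 (t : R) : 0 <= (s * t `^ (s - 1))%:E.
  by rewrite lee_fin mulr_ge0 ?powR_ge0 // ltW.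
have mf := measurable_powR_density s (s - 1).
have mfL := lebesgue_measurable_funT _ _ _ mf.
have real_case (z : R) : (0 <= z)%R ->
    \int[mu]_(t in segment0 z%:E) (s * t `^ (s - 1))%:E = (z `^ s)%:E.
  rewrite le_eqVlt => /predU1P[<-|z0].
    rewrite powR0 ?gt_eqF// (_ : segment0 0%:E = set0) ?integral_set0//.
    apply/seteqP; split => t //= -[t0]; rewrite lte_fin => /(lt_trans t0).
    by rewrite ltxx.
  rewrite (_ : segment0 z%:E = `]0%R, z[%classic); last first.
    apply/seteqP; rewrite /segment0; split => t /=; rewrite in_itv/= lte_fin.
      by move=> [-> ->].
    by move=> /andP.
  (* The shift by 2 keeps a n strictly below z already at n = 0. *)
  pose a n : R := (z / n.+2%:R)%R.
  have a0 n : (0 < a n)%R by rewrite divr_gt0.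
  have az n : (a n < z)%R by rewrite ltr_pdivrMr// ltr_pMr// ltr1n.
  have a_cvg : a n @[n --> \oo] --> 0%R.
    rewrite -(mulr0 z); apply: cvgMr.
    by have := @cvg_harmonic R; rewrite -cvg_shiftS.
  have union : \bigcup_n `[a n, z]%classic = `]0%R, z]%classic.
    apply/seteqP; split => [t [n _]|t]; rewrite /= !in_itv/= => /andP[tl tz].
      by rewrite tz (lt_le_trans (a0 n) tl).
    have [n _ /(_ n (leqnn n)) an] := cvgr0_norm_lt _ a_cvg _ tl.
    exists n => //=; rewrite in_itv/= tz andbT.
    by rewrite -(gtr0_norm (a0 n)) ltW.
  have cvg1 : \int[mu]_(t in `[a n, z]) (s * t `^ (s - 1))%:E @[n --> \oo] -->
      \int[mu]_(t in `]0%R, z]) (s * t `^ (s - 1))%:E.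
    rewrite -union; apply: ge0_nondecreasing_set_cvg_integral.
    - apply/nondecreasing_seqP => n; rewrite subsetEset => t /=.
      rewrite !in_itv/= => /andP[+ ->]; rewrite andbT; apply: le_trans.
      by rewrite ler_pM2l// lef_pV2 ?posrE// ler_nat.
    - by move=> n; apply: measurable_interval; exact: interval_is_interval.
    - by move=> n; apply: measurable_funTS.
    - by move=> n t _; exact: f0.
  (* The endpoint z, a null set, is added on the Borel side, and the completion is restored
     afterwards. *)
  rewrite integral_completed//; last exact: measurable_funTS.
  rewrite integral_itv_bndo_bndc; last exact: measurable_funTS.
  rewrite -integral_completed//; last exact: measurable_funTS.
  rewrite -(cvg_lim _ cvg1)//; apply: cvg_lim => //.
  under eq_fun do rewrite (integral_powR_itv _ _ _ (ltW s0) (a0 _) (az _)).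
  apply: cvg_EFin; first exact: nearW.
  rewrite -[X in _ --> X]subr0; apply: cvgB; first exact: cvg_cst.
  by move/cvg_at_rightP : (powR_cvg0 s0) => /(_ a); apply.
case: g => [z|_|//]; first by rewrite lee_fin => /real_case.
rewrite poweRyr ?gt_eqF//; apply/eqyP => A A0.
have c0 : (0 <= A `^ s^-1)%R by exact: powR_ge0.
(* The level A is the mass of the segment that ends at A^(1/s). *)
have -> : A%:E = ((A `^ s^-1) `^ s)%:E.
  by rewrite -powRrM mulVf ?gt_eqF// powRr1// ltW.
rewrite -(real_case _ c0); apply: ge0_subset_integral.
- exact: measurable_segment0.
- exact: measurable_segment0.
- exact: measurable_funTS.
- by move=> t _; exact: f0.
- by move=> t [t0 _]; split => //=; exact: ltry.
Qed.

End powers.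

(** * Tonelli's theorem on sections *)

(** Both sides are iterated integrals of the single non-negative function h(x) k(t) 1_S(x, t). *)
Lemma tonelli_section {d1 d2} {T1 : measurableType d1} {T2 : measurableType d2}
    {R : realType} (m1 : {sigma_finite_measure set T1 -> \bar R})
    (m2 : {sigma_finite_measure set T2 -> \bar R})
    (S : set (T1 * T2)) (h : T1 -> \bar R) (k : T2 -> \bar R) :
  measurable S -> measurable_fun setT h -> measurable_fun setT k ->
  (forall x, 0 <= h x) -> (forall t, 0 <= k t) ->
  \int[m1]_x (h x * \int[m2]_(t in xsection S x) k t) =
  \int[m2]_t (k t * \int[m1]_(x in ysection S t) h x).
Proof.
move=> mS mh mk h0 k0.
pose f z := h z.1 * (k z.2 * (\1_S z)%:E).
have mf : measurable_fun setT f.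
  apply: emeasurable_funM; first exact: (measurableT_comp mh measurable_fst).
  apply: emeasurable_funM; first exact: (measurableT_comp mk measurable_snd).
  by apply/measurable_EFinP; exact: measurable_indic.
have f0 z : 0 <= f z by rewrite /f !mule_ge0// lee_fin.
have tonelli := fubini_tonelli (m1 := m1) (m2 := m2) f mf f0.
have f1E x : \int[m2]_t f (x, t) = h x * \int[m2]_(t in xsection S x) k t.
  have mSx := measurable_xsection x mS.
  rewrite [in RHS]integral_mkcond.
  rewrite -(@ge0_integralZl _ _ _ m2 setT measurableT (k \_ (xsection S x)))//.
  - apply: eq_integral => t _; rewrite /f/= patchE indicE mem_xsection.
    by case: ifP => _; rewrite ?mule1 ?mule0.
  - by apply/(measurable_restrictT _ _).1 => //; exact: measurable_funTS.
  - by move=> t _; apply: erestrict_ge0.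
have f2E t : \int[m1]_x f (x, t) = k t * \int[m1]_(x in ysection S t) h x.
  have mSt := measurable_ysection t mS.
  rewrite [in RHS]integral_mkcond.
  rewrite -(@ge0_integralZl _ _ _ m1 setT measurableT (h \_ (ysection S t)))//.
  - apply: eq_integral => x _; rewrite /f/= patchE indicE mem_ysection.
    by case: ifP => _; rewrite ?mule1 ?mule0// muleC.
  - by apply/(measurable_restrictT _ _).1 => //; exact: measurable_funTS.
  - by move=> x _; apply: erestrict_ge0.
transitivity (\int[m1]_x \int[m2]_t f (x, t)).
  by apply: eq_integral => x _; rewrite f1E.
by rewrite tonelli; apply: eq_integral => t _; rewrite f2E.
Qed.

(** * Hoelder's inequality for extended real functions *)

Lemma ae_eq0_ge0 {d} {T : measurableType d} {R : realType} {mu : {measure set T -> \bar R}}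
    (D : set T) (u : T -> \bar R) (a : R) :
  (0 < a)%R -> measurable D -> measurable_fun D u -> (forall x, D x -> 0 <= u x) ->
  \int[mu]_(x in D) (u x `^ a) = 0 -> u = cst 0 %[ae mu in D].
Proof.
move=> a0 mD mu0 u0 I0.
have mua : measurable_fun D (fun x => u x `^ a).
  exact: (measurableT_comp (measurable_poweR a) mu0).

have : \int[mu]_(x in D) `|u x `^ a| = 0.
  by rewrite -[RHS]I0; apply: eq_integral => x _; rewrite gee0_abs ?poweR_ge0.
move=> /(ae_eq_integral_abs _ mD mua).
apply: filterS => x /= + Dx => /(_ Dx) /= uxa.
exact: (poweR_eq0_eq0 (u0 _ Dx) uxa).
Qed.

Lemma ae_fin_poweR {d} {T : measurableType d} {R : realType} {mu : {measure set T -> \bar R}}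
    (D : set T) (u : T -> \bar R) (a : R) :
  (0 < a)%R -> measurable D -> measurable_fun D u -> (forall x, D x -> 0 <= u x) ->
  \int[mu]_(x in D) (u x `^ a) < +oo -> {ae mu, forall x, D x -> u x \is a fin_num}.
Proof.
move=> a0 mD mu0 u0 I0.
have mua : measurable_fun D (fun x => u x `^ a).
  exact: (measurableT_comp (measurable_poweR a) mu0).
have /(integrable_ae mD) : mu.-integrable D (fun x => u x `^ a).
  apply/integrableP; split => //.
  by under eq_integral do rewrite gee0_abs ?poweR_ge0//.
apply: filterS => x + Dx => /(_ Dx); rewrite !ge0_fin_numE ?poweR_ge0 ?u0//.
by move/lty_poweRy; apply; rewrite gt_eqF.
Qed.

(** Reduction to real-valued functions. If U or V is 0, the product vanishes almost everywhere; if
    one is infinite and the other positive, the right-hand side is infinite; otherwise u and v are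
    finite almost everywhere. *)
Lemma ge0_hoelder {d} {T : measurableType d} {R : realType} {mu : {measure set T -> \bar R}}
    (D : set T) (u v : T -> \bar R) (a a' : R) :
  (0 < a)%R -> (0 < a')%R -> (a^-1 + a'^-1 = 1)%R ->
  measurable D -> measurable_fun D u -> measurable_fun D v ->
  (forall x, D x -> 0 <= u x) -> (forall x, D x -> 0 <= v x) ->
  \int[mu]_(x in D) (u x * v x) <=
  (\int[mu]_(x in D) (u x `^ a)) `^ a^-1 * (\int[mu]_(x in D) (v x `^ a')) `^ a'^-1.
Proof.
move=> a0 a'0 aa' mD mu0 mv u0 v0.
have mua : measurable_fun D (fun x => u x `^ a).
  exact: (measurableT_comp (measurable_poweR a) mu0).
have mva : measurable_fun D (fun x => v x `^ a').
  exact: (measurableT_comp (measurable_poweR a') mv).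
set U := \int[mu]_(x in D) (u x `^ a); set V := \int[mu]_(x in D) (v x `^ a').
have U0 : 0 <= U by apply: integral_ge0 => x _; exact: poweR_ge0.
have V0 : 0 <= V by apply: integral_ge0 => x _; exact: poweR_ge0.
have uv0 : U = 0 \/ V = 0 -> \int[mu]_(x in D) (u x * v x) = 0.
  move=> UV; rewrite -[RHS](integral0 mu D); apply: ae_eq_integral => //.
    exact: emeasurable_funM.
  case: UV => [/(ae_eq0_ge0 _ _ _ a0 mD mu0 u0)|/(ae_eq0_ge0 _ _ _ a'0 mD mv v0)];
    by apply: filterS => x /= + Dx => /(_ Dx) ->; rewrite ?mul0e ?mule0.
have [UE|U_neq0] := eqVneq U 0.
  by rewrite uv0; [rewrite mule_ge0 ?poweR_ge0|left].
have [VE|V_neq0] := eqVneq V 0.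
  by rewrite uv0; [rewrite mule_ge0 ?poweR_ge0|right].
have Ugt0 : 0 < U by rewrite lt0e U_neq0.
have Vgt0 : 0 < V by rewrite lt0e V_neq0.
have [UE|U_neqy] := eqVneq U +oo.
  by rewrite UE poweRyr ?invr_eq0 ?gt_eqF// gt0_mulye ?leey// poweR_gt0.
have [VE|V_neqy] := eqVneq V +oo.
  by rewrite VE poweRyr ?invr_eq0 ?gt_eqF// gt0_muley ?leey// poweR_gt0.
have ufin := ae_fin_poweR _ _ _ a0 mD mu0 u0 _.
have vfin := ae_fin_poweR _ _ _ a'0 mD mv v0 _.
(* [fine] replaces infinite values by 0, which here happens only on a null set. *)
pose fu := (fine \o (u \_ D))%R; pose fv := (fine \o (v \_ D))%R.
have mfu : measurable_fun setT fu.
  by apply: measurableT_comp => //; exact/(measurable_restrictT _ _).1.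
have mfv : measurable_fun setT fv.
  by apply: measurableT_comp => //; exact/(measurable_restrictT _ _).1.
have fu0 x : (0 <= fu x)%R by apply/fine_ge0/erestrict_ge0.
have fv0 x : (0 <= fv x)%R by apply/fine_ge0/erestrict_ge0.
have fE (w : T -> \bar R) : (forall x, D x -> 0 <= w x) ->
    {ae mu, forall x, D x -> w x \is a fin_num} ->
    {ae mu, forall x, (fine ((w \_ D) x))%:E = (w \_ D) x}.
  move=> w0; apply: filterS => x; rewrite patchE; case: ifPn => // xD wfin.
  by rewrite fineK// wfin// -inE.
have NE (w : T -> \bar R) (c : R) : (0 < c)%R -> (forall x, D x -> 0 <= w x) ->
    measurable_fun D w -> \int[mu]_(x in D) (w x `^ c) < +oo ->
    'N[mu]_c%:E[EFin \o (fine \o (w \_ D))] = (\int[mu]_(x in D) (w x `^ c)) `^ c^-1.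
  move=> c0 w0 mw wfin; rewrite unlock/=; congr (_ `^ _).
  rewrite [RHS]integral_mkcond; apply: ae_eq_integral => //.
  - apply/measurable_EFinP; apply: (measurableT_comp (measurable_powR c)).
    apply: measurableT_comp => //.
    by apply: measurableT_comp => //; exact/(measurable_restrictT _ _).1.
  - apply/(measurable_restrictT _ _).1 => //.
    exact: (measurableT_comp (measurable_poweR c)).
  - have := fE _ w0 (ae_fin_poweR _ _ _ c0 mD mw w0 wfin).
    apply: filterS => x /= wx _; rewrite ger0_norm; last by rewrite fine_ge0 ?erestrict_ge0.
    rewrite -poweR_EFin wx !patchE; case: ifPn => //; by rewrite poweR0r ?gt_eqF.
have Uy : U < +oo by rewrite ltey.
have Vy : V < +oo by rewrite ltey.
have := hoelder mu mfu mfv a0 a'0 aa'.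
rewrite (NE u)// (NE v)//; apply: le_trans; rewrite Lnorm1 integral_mkcond.
rewrite le_eqVlt; apply/orP; left; apply/eqP; apply: ae_eq_integral => //.
- by apply/(measurable_restrictT _ _).1 => //; exact: emeasurable_funM.
- apply/measurable_EFinP; apply: measurableT_comp => //.
  exact: measurable_funM.
- have := fE _ u0 (ae_fin_poweR _ _ _ a0 mD mu0 u0 Uy).
  apply: filterS2 (fE _ v0 (ae_fin_poweR _ _ _ a'0 mD mv v0 Vy)) => x /= vx ux _.
  rewrite /fu /fv/= ger0_norm ?mulr_ge0 ?fine_ge0 ?erestrict_ge0// EFinM ux vx !patchE.
  by case: ifPn => //; rewrite mul0e.
Qed.

(** Monotone convergence in the form needed twice, for the truncated maximal functions and for the
    truncations of b: a bound uniform in n survives the pointwise supremum. *)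
Lemma integral_ereal_sup_le {d} {T : measurableType d} {R : realType}
    (mu : {measure set T -> \bar R}) (D : set T) (G : (T -> \bar R)^nat) (B : \bar R) :
  measurable D -> (forall n, measurable_fun D (G n)) ->
  (forall n x, D x -> 0 <= G n x) ->
  (forall x, D x -> nondecreasing_seq (G ^~ x)) ->
  (forall n, \int[mu]_(x in D) G n x <= B) ->
  \int[mu]_(x in D) ereal_sup (range (G ^~ x)) <= B.
Proof.
move=> mD mG G0 ndG leB.
have -> : \int[mu]_(x in D) ereal_sup (range (G ^~ x)) =
    \int[mu]_(x in D) limn (G ^~ x).
  apply: eq_integral => x /set_mem Dx; apply/esym/cvg_lim => //.
  exact/ereal_nondecreasing_cvgn/ndG.
rewrite (monotone_convergence mu mD mG G0 ndG).
apply: lime_le; last by apply: nearW.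
apply: ereal_nondecreasing_is_cvgn => m n mn; apply: ge0_le_integral => // x Dx.
  exact: G0.
exact: ndG.
Qed.

(** * Layer-cake formula *)

Section layers.
Context {R : realType}.
Local Notation mu := (@completed_lebesgue_measure R).
Local Notation H := (halfline : set (lebesgueType R)).

Lemma measurable_EFin_lebesgue : measurable_fun [set: lebesgueType R] (@EFin R).
Proof.
apply: (@lebesgue_measurable_funT R _ _ (@EFin R)).
by apply/measurable_EFinP; exact: measurable_id.
Qed.

Lemma superlevelE (g : R -> \bar R) (t : R) :
  superlevel g t = H `&` [set x | t%:E < g x].
Proof. by apply/seteqP; split => x /=; rewrite halflineE. Qed.

Lemma measurable_superlevel (g : R -> \bar R) (t : R) : measurable_fun H g ->
  measurable (superlevel g t : set (lebesgueType R)).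
Proof.
by move=> mg; rewrite superlevelE; apply: emeasurable_fun_o_infty => //;
  exact: measurable_halfline.
Qed.

Lemma superlevel_sub (g : R -> \bar R) (t : R) : superlevel g t `<=` halfline.
Proof. by move=> x [x0 _]; rewrite halflineE. Qed.

Lemma tonelli_segment0 (h k g : R -> \bar R) :
  measurable_fun H h -> measurable_fun H k -> measurable_fun H g ->
  (forall x, halfline x -> 0 <= h x) -> (forall x, halfline x -> 0 <= k x) ->
  \int[mu]_(x in H) (h x * \int[mu]_(t in segment0 (g x)) k t) =
  \int[mu]_(t in H) (k t * \int[mu]_(x in superlevel g t) h x).
Proof.
move=> mh mk mg h0 k0; have mH := @measurable_halfline R.
(* The functions are controlled only on the half-line, so they are extended by zero. The region S
   below may contain points with x <= 0 or t <= 0, but there [hh] or [kk] vanishes. *)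
pose hh := (h \_ H : lebesgueType R -> \bar R).
pose kk := (k \_ H : lebesgueType R -> \bar R).
pose gg := (g \_ H : lebesgueType R -> \bar R).
have mhh : measurable_fun setT hh by exact/(measurable_restrictT _ _).1.
have mkk : measurable_fun setT kk by exact/(measurable_restrictT _ _).1.
have mgg : measurable_fun setT gg by exact/(measurable_restrictT _ _).1.
have hh0 x : 0 <= hh x by exact: erestrict_ge0.
have kk0 x : 0 <= kk x by exact: erestrict_ge0.
pose S := [set z : lebesgueType R * lebesgueType R | z.2%:E < gg z.1].
have mS : measurable S.
  rewrite -[S]setTI; apply: measurable_lte => //.
  - exact: (measurableT_comp measurable_EFin_lebesgue measurable_snd).
  - exact: (measurableT_comp mgg measurable_fst).
pose lhs := \int[mu]_x (hh x * \int[mu]_(t in xsection S x) kk t).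
pose rhs := \int[mu]_t (kk t * \int[mu]_(x in ysection S t) hh x).
have tonelli : lhs = rhs by exact: tonelli_section.
suff [-> ->] : \int[mu]_(x in H) (h x * \int[mu]_(t in segment0 (g x)) k t) = lhs /\
  \int[mu]_(t in H) (k t * \int[mu]_(x in superlevel g t) h x) = rhs by [].
split.
- rewrite /lhs integral_mkcond; apply: eq_integral => x _; rewrite patchE.
  case: ifPn => xH; last by rewrite /hh patchE (negbTE xH) mul0e.
  rewrite /hh patchE xH; congr (_ * _).
  rewrite integral_mkcond [RHS]integral_mkcond; apply: eq_integral => t _.
  rewrite /kk !patchE mem_xsection.
  have -> : (t \in segment0 (g x)) = (t \in H) && ((x, t) \in S).
    apply/idP/andP; rewrite !inE/= halflineE /S /gg/= patchE xH.
      by clear; case.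
    by clear; case.
  by case: (t \in H); case: ifP.
- rewrite /rhs integral_mkcond; apply: eq_integral => t _; rewrite patchE.
  case: ifPn => tH; last by rewrite /kk patchE (negbTE tH) mul0e.
  rewrite /kk patchE tH; congr (_ * _).
  rewrite integral_mkcond [RHS]integral_mkcond; apply: eq_integral => x _.
  rewrite /hh !patchE mem_ysection.
  have [xH|xH] := boolP (x \in H); last first.
    rewrite if_same memNset; first reflexivity.
    by case=> x0 _; move: x0 xH; clear; rewrite notin_setE halflineE.
  have -> : (x \in superlevel g t) = ((x, t) \in S).
    apply/idP/idP; rewrite !inE/= /S /gg/= patchE xH; first by case.
    by move: xH; clear; rewrite inE halflineE => x0 tgx; split.
  by [].
Qed.

Lemma measurable_powR_halfline (s c : R) :
  measurable_fun H (fun t : R => (s * t `^ c)%:E).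
Proof.
apply: measurable_funTS; apply: (@lebesgue_measurable_funT R).
exact: measurable_powR_density.
Qed.

(** Write g(x)^s as the integral of s t^(s-1) over (0, g(x)) and exchange the order of
    integration. *)
Lemma layer_cake (s : R) (h g : R -> \bar R) : (0 < s)%R ->
  measurable_fun H h -> measurable_fun H g ->
  (forall x, halfline x -> 0 <= h x) -> (forall x, halfline x -> 0 <= g x) ->
  \int[mu]_(x in H) (h x * g x `^ s) =
  \int[mu]_(t in H) ((s * t `^ (s - 1))%:E * \int[mu]_(x in superlevel g t) h x).
Proof.
move=> s0 mh mg h0 g0; rewrite -tonelli_segment0.
- apply: eq_integral => x /set_mem Hx.
  by rewrite integral_powR_segment0// g0.
- exact: mh.
- exact: measurable_powR_halfline.
- exact: mg.
- exact: h0.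
- by move=> t _; rewrite lee_fin mulr_ge0 ?powR_ge0// ltW.
Qed.

Lemma measurable_superlevel_integral (h g : R -> \bar R) :
  measurable_fun H h -> measurable_fun H g -> (forall x, halfline x -> 0 <= h x) ->
  measurable_fun H (fun t => \int[mu]_(x in superlevel g t) h x).
Proof.
move=> mh mg h0; apply: measurable_nonincreasing => s t s0 st.
apply: ge0_subset_integral.
- exact: measurable_superlevel.
- exact: measurable_superlevel.
- by apply: measurable_funS mh; [exact: measurable_halfline|exact: superlevel_sub].
- by move=> x /superlevel_sub; exact: h0.
- by move=> x [x0 tx]; split => //; apply: le_lt_trans tx; rewrite lee_fin.
Qed.

Lemma mu_segment0 (c : R) : (0 <= c)%R -> mu (segment0 c%:E) = c%:E.
Proof.
move=> c0; have -> : segment0 c%:E = `]0%R, c[%classic :> set R.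
  apply/seteqP; rewrite /segment0; split => t /=; rewrite in_itv/= lte_fin.
    by move=> [-> ->].
  by move=> /andP.
rewrite -[LHS]/(@lebesgue_measure R `]0%R, c[%classic) lebesgue_measure_itv/= lte_fin.
by case: ltgtP c0 => // [|<-]; rewrite ?oppr0 ?adde0// => _ _; rewrite sube0.
Qed.

Lemma pnormE (p : R) (f : R -> \bar R) : (0 < p)%R ->
  (forall x, halfline x -> 0 <= f x) ->
  pnorm p f = (\int[mu]_(x in H) (f x `^ p)) `^ p^-1.
Proof.
move=> p0 f0; rewrite /pnorm unlock/=; congr (_ `^ _).
rewrite [RHS]integral_mkcond; apply: eq_integral => x _; rewrite !patchE.
case: ifPn => [/set_mem Hx|_]; first by rewrite gee0_abs// f0.
by rewrite abse0 poweR0r// gt_eqF.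
Qed.

End layers.

(** * The one-sided maximal function *)

Section maximal_function.
Context {R : realType}.
Local Notation mu := (@completed_lebesgue_measure R).
Local Notation H := (halfline : set (lebesgueType R)).
Variable f : R -> \bar R.
Hypothesis mf : measurable_fun H f.
Hypothesis f0 : forall x, halfline x -> 0 <= f x.

Definition average (z : R) : \bar R := (z^-1)%:E * \int[mu]_(t in segment0 z%:E) f t.

(** The function K of the overview, with n capping both the averages and the endpoints z; it is thus
    bounded and zero beyond n. Adjoining 0 gives the value 0, not -oo, when no z is admissible. *)
Definition trunc_maximal (n : nat) (y : R) : \bar R :=
  ereal_sup (0 |` [set mine n%:R%:E (average z) | z in
    [set z | [/\ (0 < z)%R, (y <= z)%R & (z <= n%:R)%R]]]).

Lemma trunc_maximal_ge0 n y : 0 <= trunc_maximal n y.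
Proof. by apply: ereal_sup_ubound; left. Qed.

Lemma trunc_maximal_le n y : trunc_maximal n y <= n%:R%:E.
Proof.
apply: ge_ereal_sup => _ [->|[z _ <-]]; first by rewrite lee_fin.
by rewrite ge_min lexx.
Qed.

Lemma trunc_maximal_eq0 n y : (n%:R < y)%R -> trunc_maximal n y = 0.
Proof.
move=> ny; apply/eqP; rewrite eq_le trunc_maximal_ge0 andbT.
apply: ge_ereal_sup => _ [->//|[z [_ yz zn] <-]].
by have := lt_le_trans ny (le_trans yz zn); rewrite ltxx.
Qed.

Lemma le_trunc_maximal n x y : (x <= y)%R -> trunc_maximal n y <= trunc_maximal n x.
Proof.
move=> xy; apply: le_ereal_sup => m [m0|[z [z0 yz zn] <-]]; [by left|right].
by exists z => //; split => //; exact: le_trans yz.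
Qed.

Lemma trunc_maximal_nd y : nondecreasing_seq (trunc_maximal ^~ y).
Proof.
move=> m n mn; apply: ge_ereal_sup => _ [->|[z [z0 yz zm] <-]].
  exact: trunc_maximal_ge0.
have mnR : (m%:R <= n%:R :> R)%R by rewrite ler_nat.
apply: (@le_trans _ _ (mine n%:R%:E (average z))).
  by rewrite le_min !ge_min lee_fin mnR lexx orbT.
apply: ereal_sup_ubound; right; exists z => //; split => //.
exact: le_trans mnR.
Qed.

Lemma average_trunc_maximal n y z : (0 < z)%R -> (y <= z)%R -> (z <= n%:R)%R ->
  mine n%:R%:E (average z) <= trunc_maximal n y.
Proof. by move=> z0 yz zn; apply: ereal_sup_ubound; right; exists z. Qed.

Lemma measurable_trunc_maximal n : measurable_fun H (trunc_maximal n).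
Proof. by apply: measurable_nonincreasing => x y _; exact: le_trunc_maximal. Qed.

(** If x lies in the level set S, some z >= x has average above l. Then (0, z) lies in S, so l x <=
    l z is at most the integral of f over S. With A for that integral, S lies in (0, A/l]. *)
Lemma superlevel_trunc_maximal n (l : R) : (0 < l)%R ->
  l%:E * mu (superlevel (trunc_maximal n) l) <=
  \int[mu]_(x in superlevel (trunc_maximal n) l) f x.
Proof.
move=> l0; set S := superlevel _ _.
have mS : measurable (S : set (lebesgueType R)).
  exact: measurable_superlevel (measurable_trunc_maximal n).
have mfS : measurable_fun (S : set (lebesgueType R)) f.
  by apply: measurable_funS mf; [exact: measurable_halfline|exact: superlevel_sub].
have A0 : 0 <= \int[mu]_(x in S) f x.
  by apply: integral_ge0 => x /superlevel_sub; exact: f0.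
have Sle x : S x -> (l * x)%:E <= \int[mu]_(x in S) f x.
  move=> [x0 /ereal_sup_gt[_ [->|[z [z0 xz zn] <-]]]].
    by rewrite lte_fin ltNge (ltW l0).
  rewrite lt_min => /andP[ln lav].
  apply: (@le_trans _ _ (\int[mu]_(t in segment0 z%:E) f t)).
    apply: (@le_trans _ _ (l * z)%:E); first by rewrite lee_fin ler_pM2l.
    rewrite mulrC EFinM -lee_pdivlMl//; exact: ltW.
  apply: ge0_subset_integral.
  - exact: measurable_segment0.
  - exact: mS.
  - exact: mfS.
  - by move=> y /superlevel_sub; exact: f0.
  (* For y < z the same endpoint z is admissible, so it also witnesses that y belongs to S. *)
  - move=> y [y0 yz]; split => //.
    apply: (@lt_le_trans _ _ (mine n%:R%:E (average z))); first by rewrite lt_min ln.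
    by apply: average_trunc_maximal => //; move: yz; rewrite lte_fin => /ltW.
move: A0 Sle; case: (\int[mu]_(x in S) f x) => [A|_ _|//]; last by rewrite leey.
rewrite lee_fin => A0 Sle.
(* Segments are open at the right end, so S is placed in (0, c) for every c > A/l, and c then
   decreases to A/l. *)
have SA c : (A / l < c)%R -> mu S <= c%:E.
  move=> Ac; have c0 : (0 <= c)%R by apply: ltW; apply: le_lt_trans Ac; rewrite divr_ge0// ltW.
  rewrite -(mu_segment0 _ c0); apply: le_measure; rewrite ?inE.
  - exact: mS.
  - exact: measurable_segment0.
  - move=> x Sx; have [x0 _] := Sx; split => //.
    rewrite lte_fin; apply: le_lt_trans Ac.
    by rewrite ler_pdivlMr// mulrC -lee_fin; exact: Sle.
rewrite -lee_pdivlMl// -EFinM mulrC; apply/lee_addgt0Pr => e e0.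
by rewrite -EFinD; apply: SA; rewrite ltrDl.
Qed.

End maximal_function.

(** * Doob's maximal inequality and the non-increasing majorant *)

Section maximal_inequality.
Context {R : realType}.
Local Notation mu := (@completed_lebesgue_measure R).
Local Notation H := (halfline : set (lebesgueType R)).

Lemma measurable_poweR_fun (c : R) (g : R -> \bar R) : measurable_fun H g ->
  measurable_fun H (fun x => g x `^ c).
Proof. exact: (measurableT_comp (measurable_poweR c)). Qed.

Lemma le_poweR (c : R) (x y : \bar R) : (0 <= c)%R -> 0 <= x -> x <= y ->
  x `^ c <= y `^ c.
Proof.
move=> c0 x0 xy; apply: (gt0_ler_poweR c0) => //; rewrite in_itv/= leey andbT//.
exact: le_trans xy.
Qed.

(** This finiteness is what permits dividing by a power of the integral in [poweR_conj_le]. *)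
Lemma trunc_maximal_fin (f : R -> \bar R) (p : R) n : (0 < p)%R ->
  measurable_fun H f -> (forall x, halfline x -> 0 <= f x) ->
  \int[mu]_(x in H) (trunc_maximal f n x `^ p) < +oo.
Proof.
move=> p0 mf f0; have c0 : (0 <= n.+1%:R :> R)%R by [].
(* The segment reaches to n + 1 because it is open and the truncated maximal function need not
   vanish at n itself. *)
apply: (@le_lt_trans _ _ (\int[mu]_(x in segment0 n.+1%:R%:E) (cst (n%:R `^ p)%:E x))).
  rewrite integral_mkcond [leRHS]integral_mkcond; apply: ge0_le_integral.
  - exact: measurableT.
  - by move=> x _; apply: erestrict_ge0 => y _; exact: poweR_ge0.
  - apply/(measurable_restrictT _ _).1; first exact: measurable_halfline.
    exact/measurable_poweR_fun/measurable_trunc_maximal.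
  - apply/(measurable_restrictT _ _).1; first exact: measurable_segment0.
    exact: measurable_cst.
  - move=> x _; rewrite !patchE; case: ifPn => xH; last first.
      by case: ifP; rewrite // lee_fin powR_ge0.
    case: ifPn => xn.
      rewrite -poweR_EFin; apply: le_poweR; first exact: ltW.
        exact: trunc_maximal_ge0.
      exact: trunc_maximal_le.
    rewrite trunc_maximal_eq0 ?poweR0r ?gt_eqF//.
    move: xn; apply: contraNT; rewrite -leNgt => xn; rewrite inE; split.
      by move: xH; rewrite inE halflineE.
    by rewrite lte_fin (le_lt_trans xn)// ltr_nat.
rewrite integral_cst; last exact: measurable_segment0.
rewrite [X in _ * X](_ : _ = n.+1%:R%:E); last exact: (mu_segment0 _ c0).
by rewrite -EFinM ltry.
Qed.

(** For I > 0, dividing by the finite number I^(1/p') leaves I^(1/p) <= c, because 1 - 1/p' =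
    1/p. *)
Lemma poweR_conj_le (p p' c : R) (I : \bar R) : (1 < p)%R -> (p^-1 + p'^-1 = 1)%R ->
  (0 <= c)%R -> 0 <= I -> I < +oo -> I <= c%:E * I `^ p'^-1 -> I <= (c `^ p)%:E.
Proof.
move=> p1 pp' c0; case: I => [I|//|//]; rewrite !lee_fin => I0 _ Ic.
have p0 : (0 < p)%R by lra.
move: I0; rewrite le_eqVlt => /predU1P[<-|I0]; first exact: powR_ge0.
have Ip : (I `^ p^-1 <= c)%R.
  rewrite -(ler_pM2r (powR_gt0 p'^-1 I0)) -powRD; last by apply/implyP => _; rewrite gt_eqF.
  by rewrite pp' powRr1// ltW.
have -> : (I = (I `^ p^-1) `^ p)%R by rewrite -powRrM mulVf ?gt_eqF// powRr1// ltW.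
by rewrite ge0_ler_powR// ?nnegrE ?powR_ge0// ltW.
Qed.

(* Doob's argument: integrating the weak-type estimate against p l^(p-2) dl
   and applying Hoelder's inequality. *)
Lemma trunc_maximal_inequality (f : R -> \bar R) (p p' : R) n : (1 < p)%R ->
  (p^-1 + p'^-1 = 1)%R ->
  measurable_fun H f -> (forall x, halfline x -> 0 <= f x) ->
  \int[mu]_(x in H) (trunc_maximal f n x `^ p) <=
  (p' `^ p)%:E * \int[mu]_(x in H) (f x `^ p).
Proof.
move=> p1 pp' mf f0; have p0 : (0 < p)%R by lra.
have mH := @measurable_halfline R.
set K := trunc_maximal f n.
have K0 x : 0 <= K x by exact: trunc_maximal_ge0.
have mK : measurable_fun H K by exact: measurable_trunc_maximal.
have p'E : (p' = p / (p - 1))%R.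
  have -> : (p' = (1 - p^-1)^-1)%R by rewrite -pp' addrC addKr invrK.
  by field; rewrite subr_eq0 !gt_eqF.
have p'0 : (0 < p')%R by rewrite p'E divr_gt0// subr_gt0.
set Phi := \int[mu]_(x in H) (f x `^ p).
have Phi0 : 0 <= Phi by apply: integral_ge0 => x _; exact: poweR_ge0.
set I := \int[mu]_(x in H) (K x `^ p).
have I0 : 0 <= I by apply: integral_ge0 => x _; exact: poweR_ge0.
have Ify : I < +oo by exact: trunc_maximal_fin.
have [Phiy|Phiy] := eqVneq Phi +oo.
  by rewrite Phiy gt0_muley ?leey// lte_fin powR_gt0.
have Phifin : Phi \is a fin_num by rewrite ge0_fin_numE// ltey.
have I1 : I = \int[mu]_(t in H) ((p * t `^ (p - 1))%:E * mu (superlevel K t)).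
  rewrite /I (_ : \int[mu]_(x in H) _ = \int[mu]_(x in H) (cst 1 x * K x `^ p)).
    rewrite (layer_cake p (cst 1) K p0 (measurable_cst _) mK (fun _ _ => lee01)
      (fun x _ => K0 x)).
    apply: eq_integral => t _; congr (_ * _).
    by rewrite integral_cst ?mul1e//; exact: measurable_superlevel.
  by apply: eq_integral => x _; rewrite mul1e.
(* The density p t^(p-1) is split as p' (p-1) t^(p-2) times t, and the factor t is spent on the
   weak-type estimate. *)
have I2 : I <= \int[mu]_(t in H) (p'%:E * (((p - 1) * t `^ (p - 1 - 1))%:E *
                                   \int[mu]_(x in superlevel K t) f x)).
  rewrite I1; apply: ge0_le_integral; first exact: mH.
  - move=> t _; rewrite mule_ge0// lee_fin mulr_ge0 ?powR_ge0// ltW//.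
  - apply: emeasurable_funM; first exact: measurable_powR_halfline.
    have := measurable_superlevel_integral (cst 1) K (measurable_cst _) mK.
    move=> /(_ (fun x _ => lee01)); apply: eq_measurable_fun => t _.
    by rewrite integral_cst ?mul1e//; exact: measurable_superlevel.
  - apply: emeasurable_funM; first exact: measurable_cst.
    apply: emeasurable_funM; first exact: measurable_powR_halfline.
    exact: measurable_superlevel_integral.
  - move=> t; rewrite halflineE => t0.
    have -> : ((p * t `^ (p - 1))%:E = (p' * ((p - 1) * t `^ (p - 1 - 1)))%:E * t%:E)%E.
      rewrite -EFinM; congr EFin.
      have := mulr_powRB1 (ltW t0) (_ : (0 < p - 1)%R).
      rewrite subr_gt0 => /(_ p1) <-; rewrite p'E; field.
      by rewrite subr_eq0 gt_eqF.
    rewrite -muleA [leRHS]muleA -EFinM lee_pmul2l ?lte_fin//.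
    + exact: superlevel_trunc_maximal.
    + by rewrite !mulr_gt0 ?subr_gt0 ?powR_gt0.
(* The layer-cake formula read backwards, now with weight f and exponent p - 1. *)
have I3 : I <= p'%:E * \int[mu]_(x in H) (f x * K x `^ (p - 1)).
  have p10 : (0 < p - 1)%R by rewrite subr_gt0.
  rewrite (layer_cake (p - 1) f K p10 mf mK f0 (fun x _ => K0 x)).
  rewrite -ge0_integralZl; first exact: I2.
  - exact: mH.
  - apply: emeasurable_funM; first exact: measurable_powR_halfline.
    exact: measurable_superlevel_integral.
  - move=> t _; rewrite mule_ge0//; first by rewrite lee_fin mulr_ge0 ?powR_ge0// subr_ge0 ltW.
    by apply: integral_ge0 => x /superlevel_sub; exact: f0.
  - by rewrite lee_fin ltW.
have : I <= (p' * fine (Phi `^ p^-1))%:E * I `^ p'^-1.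
  apply: (le_trans I3); rewrite EFinM fineK ?fin_num_poweR// -muleA.
  rewrite lee_pmul2l ?lte_fin//.
  (* Since (p - 1) p' = p, the second factor of Hoelder's inequality is I^(1/p'). *)
  have := @ge0_hoelder _ _ R mu H f (fun x => K x `^ (p - 1)) p p' p0 p'0 pp' mH mf
    (measurable_poweR_fun _ _ mK) f0 (fun x _ => poweR_ge0 _ _).
  rewrite -/Phi; congr (_ <= _ * (_ `^ _)).
  apply: eq_integral => x _; rewrite -poweRrM p'E mulrCA mulfV ?mulr1//.
  by rewrite gt_eqF// subr_gt0.
move=> /(poweR_conj_le _ _ _ _ p1 pp' _ I0 Ify).
move=> /(_ (mulr_ge0 (ltW p'0) (fine_ge0 (poweR_ge0 _ _)))).
move=> /le_trans; apply; rewrite powRM ?(ltW p'0) ?fine_ge0 ?poweR_ge0// EFinM.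
by rewrite -fine_poweR -poweRrM mulVf ?gt_eqF// poweRe1// fineK.
Qed.

(** The upper bound uses K only through these four properties. The inequality for the truncated
    maximal functions has a constant independent of n, so it passes to their supremum. *)
Lemma maximal_majorant (f : R -> \bar R) (p p' : R) : (1 < p)%R ->
  (p^-1 + p'^-1 = 1)%R ->
  measurable_fun H f -> (forall x, halfline x -> 0 <= f x) ->
  exists K : R -> \bar R, [/\ forall y, 0 <= K y,
    forall x y, (0 < x)%R -> (x <= y)%R -> K y <= K x,
    forall z, (0 < z)%R -> \int[mu]_(t in segment0 z%:E) f t <= z%:E * K z &
    \int[mu]_(x in H) (K x `^ p) <= (p' `^ p)%:E * \int[mu]_(x in H) (f x `^ p)].
Proof.
move=> p1 pp' mf f0; have p0 : (0 < p)%R by lra.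
(* The supremum is taken over p-th powers, whose integrals are the bounded quantities; the root is
   extracted afterwards. *)
pose G n y := trunc_maximal f n y `^ p.
have leG n x m y : trunc_maximal f n x <= trunc_maximal f m y -> G n x <= G m y.
  by apply: le_poweR; [exact: ltW|exact: trunc_maximal_ge0].
pose S y := ereal_sup (range (G ^~ y)).
have S_ge n y : G n y <= S y by apply: ereal_sup_ubound; exists n.
have S0 y : 0 <= S y by apply: le_trans (S_ge 0%N y); exact: poweR_ge0.
have SK y : (S y `^ p^-1) `^ p = S y by rewrite -poweRrM mulVf ?gt_eqF// poweRe1.
exists (fun y => S y `^ p^-1); split.
- by move=> y; exact: poweR_ge0.
- move=> x y x0 xy; apply: le_poweR => //; first by rewrite invr_ge0 ltW.
  apply: ge_ereal_sup => _ [n _ <-]; apply: le_trans (S_ge n x).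
  exact/leG/le_trunc_maximal.
- move=> z z0; rewrite -lee_pdivrMl//.
  change (average f z <= S z `^ p^-1).
  have large n : (z <= n%:R)%R -> mine n%:R%:E (average f z) <= S z `^ p^-1.
    move=> zn; apply: (@le_trans _ _ (trunc_maximal f n z)).
      exact: average_trunc_maximal.
    have -> : trunc_maximal f n z = G n z `^ p^-1.
      by rewrite -poweRrM mulfV ?gt_eqF// poweRe1//; exact: trunc_maximal_ge0.
    by apply: le_poweR => //; [rewrite invr_ge0 ltW|exact: poweR_ge0].
  apply: contraPP (ltxx (S z `^ p^-1)) => /negP; rewrite -ltNge => lt_av.
  have Sfin : S z `^ p^-1 \is a fin_num.
    by rewrite ge0_fin_numE ?poweR_ge0//; apply: lt_le_trans lt_av (leey _).
  (* Exceeding z makes z an admissible endpoint; exceeding S(z)^(1/p) makes the capped average still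
     larger than S(z)^(1/p), a contradiction. *)
  pose n := Num.bound (Num.max z (fine (S z `^ p^-1))).
  have nz : (Num.max z (fine (S z `^ p^-1)) < n%:R)%R.
    by rewrite archi_boundP// le_max (ltW z0).
  move: nz; rewrite gt_max => /andP[nz nS].
  move=> _; have := large n (ltW nz); rewrite leNgt => /negP; apply.
  by rewrite lt_min lt_av -[X in X < _]fineK// lte_fin nS.
- under eq_integral do rewrite SK.
  apply: integral_ereal_sup_le.
  + exact: measurable_halfline.
  + by move=> n; exact/measurable_poweR_fun/measurable_trunc_maximal.
  + by move=> n x _; exact: poweR_ge0.
  + by move=> x _ m n mn; exact/leG/trunc_maximal_nd.
  + by move=> n; exact: trunc_maximal_inequality.
Qed.

End maximal_inequality.

(** * The distribution function of a normal form parameter *)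

Section level_measure.
Context {R : realType}.
Local Notation mu := (@completed_lebesgue_measure R).
Local Notation H := (halfline : set (lebesgueType R)).
Variable b : R -> \bar R.
Hypothesis b_nfp : normal_form_parameter b.

Lemma nfp_ge0 x : halfline x -> 0 <= b x.
Proof. by case: b_nfp => + _; apply. Qed.

Lemma nfp_le x y : (0 < x)%R -> (x <= y)%R -> b y <= b x.
Proof.
move=> x0 xy; case: b_nfp => _; apply => //; rewrite halflineE//.
exact: lt_le_trans xy.
Qed.

Lemma measurable_nfp : measurable_fun H b.
Proof. exact: measurable_nonincreasing nfp_le. Qed.

(** The distribution function w of b, which acts as a generalised inverse of b. *)
Definition level_measure (t : R) : \bar R := mu (superlevel b t).

Lemma level_measure_ge0 t : 0 <= level_measure t.
Proof. exact: measure_ge0. Qed.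

Lemma measurable_level_measure : measurable_fun H level_measure.
Proof.
apply: measurable_nonincreasing => s t s0 st; apply: le_measure; rewrite ?inE.
- exact/measurable_superlevel/measurable_nfp.
- exact/measurable_superlevel/measurable_nfp.
- by move=> x [x0 tx]; split => //; apply: le_lt_trans tx; rewrite lee_fin.
Qed.

(** If b(x) <= t, monotonicity confines {b > t} to (0, x), whose measure is x. *)
Lemma lt_level_measure x t : (0 < x)%R -> x%:E < level_measure t -> t%:E < b x.
Proof.
move=> x0; rewrite !ltNge; apply: contra => bxt.
rewrite -(mu_segment0 _ (ltW x0)); apply: le_measure; rewrite ?inE.
- exact/measurable_superlevel/measurable_nfp.
- exact: measurable_segment0.
- move=> y [y0 ty]; split => //; rewrite lte_fin ltNge; apply/negP => xy.
  by have := lt_le_trans ty (le_trans (nfp_le _ _ x0 xy) bxt); rewrite ltxx.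
Qed.

(** If t < b(x), then (0, x) lies in {b > t}. The conclusion is not strict, since {b > t} may be
    exactly (0, x]. *)
Lemma le_level_measure x t : (0 < x)%R -> t%:E < b x -> x%:E <= level_measure t.
Proof.
move=> x0 tbx; rewrite -(mu_segment0 _ (ltW x0)); apply: le_measure; rewrite ?inE.
- exact: measurable_segment0.
- exact/measurable_superlevel/measurable_nfp.
- move=> y [y0 yx]; split => //; apply: lt_le_trans tbx _.
  by apply: nfp_le => //; move: yx; rewrite lte_fin => /ltW.
Qed.

(** Apply the layer-cake formula to w^s. The inner set {w > x} lies in (0, b(x)), on which c t^(c-1)
    has integral b(x)^c. The inclusion gives the direction that both bounds use. *)
Lemma level_measure_integral (c s : R) : (0 < c)%R -> (0 < s)%R ->
  \int[mu]_(t in H) ((c * t `^ (c - 1))%:E * level_measure t `^ s) <=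
  \int[mu]_(x in H) ((s * x `^ (s - 1))%:E * b x `^ c).
Proof.
move=> c0 s0; have dens0 (u v x : R) : (0 < u)%R -> 0 <= (u * x `^ v)%:E.
  by move=> u0; rewrite lee_fin mulr_ge0 ?powR_ge0// ltW.
rewrite (layer_cake s (fun t => (c * t `^ (c - 1))%:E) level_measure s0
  (measurable_powR_halfline _ _) measurable_level_measure
  (fun x _ => dens0 _ _ x c0) (fun x _ => level_measure_ge0 x)).
apply: ge0_le_integral.
- exact: measurable_halfline.
- move=> x _; rewrite mule_ge0 ?dens0//.
  by apply: integral_ge0 => t _; exact: dens0.
- apply: emeasurable_funM; first exact: measurable_powR_halfline.
  apply: measurable_superlevel_integral; first exact: measurable_powR_halfline.
    exact: measurable_level_measure.
  by move=> t _; exact: dens0.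
- apply: emeasurable_funM; first exact: measurable_powR_halfline.
  exact/measurable_poweR_fun/measurable_nfp.
- move=> x; rewrite halflineE => x0; apply: lee_pmul => //.
  + exact: dens0.
  + by apply: integral_ge0 => t _; exact: dens0.
  + rewrite -integral_powR_segment0//; last by apply: nfp_ge0; rewrite halflineE.
    apply: ge0_subset_integral.
    * exact/measurable_superlevel/measurable_level_measure.
    * exact: measurable_segment0.
    * apply: measurable_funS (measurable_powR_halfline _ _).
        exact: measurable_halfline.
      exact: segment0_sub.
    * by move=> t _; exact: dens0.
    * by move=> t [t0 xt]; split => //; exact: lt_level_measure.
Qed.

Lemma hardyE (f : R -> \bar R) x :
  hardy b f x = \int[mu]_(t in segment0 (b x)) f t.
Proof. by []. Qed.

Lemma hardy_ge0 (f : R -> \bar R) x : Lplus f -> 0 <= hardy b f x.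
Proof. by move=> [_ f0]; apply: integral_ge0 => t /segment0_sub; exact: f0. Qed.

Lemma le_segment0_integral (f : R -> \bar R) (u v : \bar R) : Lplus f -> u <= v ->
  \int[mu]_(t in segment0 u) f t <= \int[mu]_(t in segment0 v) f t.
Proof.
move=> [mf f0] uv; apply: ge0_subset_integral.
- exact: measurable_segment0.
- exact: measurable_segment0.
- by apply: measurable_funS mf; [exact: measurable_halfline|exact: segment0_sub].
- by move=> t /segment0_sub; exact: f0.
- by move=> t [t0 tu]; split => //; exact: lt_le_trans uv.
Qed.

Lemma measurable_hardy (f : R -> \bar R) : Lplus f -> measurable_fun H (hardy b f).
Proof.
move=> Lf; apply: measurable_nonincreasing => x y x0 xy.
exact/le_segment0_integral/nfp_le.
Qed.

(* Since K is non-increasing, b^q K(b)^q is at most the integral of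
   q t^(q-1) K(t)^q over (0, b). *)
Lemma hardy_poweR_le (f K : R -> \bar R) (q : R) x : (0 < q)%R ->
  Lplus f -> (forall y, 0 <= K y) ->
  (forall y z, (0 < y)%R -> (y <= z)%R -> K z <= K y) ->
  (forall z, (0 < z)%R -> \int[mu]_(t in segment0 z%:E) f t <= z%:E * K z) ->
  (0 < x)%R -> b x < +oo ->
  hardy b f x `^ q <=
  \int[mu]_(t in segment0 (b x)) ((q * t `^ (q - 1))%:E * K t `^ q).
Proof.
move=> q0 Lf K0 K_ni fK x0 bxy.
have dens0 (t : R) : 0 <= (q * t `^ (q - 1))%:E.
  by rewrite lee_fin mulr_ge0 ?powR_ge0// ltW.
have mdens : measurable_fun (segment0 (b x) : set (lebesgueType R))
    (fun t : R => (q * t `^ (q - 1))%:E).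
  apply: measurable_funS (measurable_powR_halfline _ _).
    exact: measurable_halfline.
  exact: segment0_sub.
have mK : measurable_fun (segment0 (b x) : set (lebesgueType R)) (fun t => K t `^ q).
  apply: (@measurable_funS _ _ _ _ H); first exact: measurable_halfline.
    exact: segment0_sub.
  exact/measurable_poweR_fun/measurable_nonincreasing.
have bx0 : 0 <= b x by apply: nfp_ge0; rewrite halflineE.
rewrite hardyE; move: (b x) bx0 bxy mdens mK => [B|//|//]; rewrite lee_fin.
(* The estimate by z K(z) is assumed only for z > 0; at B = 0 both integrals are over the empty
   set. *)
rewrite le_eqVlt => /predU1P[<-|B0] _ mdens mK.
  have -> : segment0 0%:E = set0 :> set R.
    apply/seteqP; split => t //= -[t0]; rewrite lte_fin => /(lt_trans t0).
    by rewrite ltxx.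
  by rewrite !integral_set0 poweR0r ?gt_eqF.
apply: (@le_trans _ _ ((B%:E * K B) `^ q)).
  apply: le_poweR; [exact: ltW| |exact: fK].
  by apply: integral_ge0 => t /segment0_sub; case: Lf => _; apply.
rewrite poweRM ?lee_fin ?(ltW B0)// -integral_powR_segment0 ?lee_fin ?(ltW B0)//.
rewrite -ge0_integralZr.
- apply: ge0_le_integral.
  + exact: measurable_segment0.
  + by move=> t _; rewrite mule_ge0 ?poweR_ge0.
  + by apply: emeasurable_funM => //; exact: measurable_cst.
  + exact: emeasurable_funM.
  + move=> t [t0]; rewrite lte_fin => /ltW tB; apply: lee_pmul => //.
      exact: poweR_ge0.
    by apply: le_poweR; [exact: ltW|exact: K0|exact: K_ni].
- exact: measurable_segment0.
- exact: mdens.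
- by move=> t _; exact: dens0.
- exact: poweR_ge0.
Qed.

End level_measure.

(** * Exponents and constants *)

Section exponents.
Context {R : realType}.
Variables p q r p' : R.
Hypotheses (q0 : (0 < q)%R) (qp : (q < p)%R) (p1 : (1 < p)%R).
Hypotheses (pp' : (p^-1 + p'^-1 = 1)%R) (rE : (r^-1 = q^-1 - p^-1)%R).

Let p_neq0 : (p != 0)%R. Proof. exact: lt0r_neq0 (lt_trans q0 qp). Qed.
Let q_neq0 : (q != 0)%R. Proof. by rewrite gt_eqF. Qed.
Let p1_neq0 : (p - 1 != 0)%R. Proof. by rewrite gt_eqF// subr_gt0. Qed.
Let pq_neq0 : (p - q != 0)%R. Proof. by rewrite gt_eqF// subr_gt0. Qed.

Lemma conjugateE : (p' = p / (p - 1))%R.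
Proof.
have -> : (p' = (1 - p^-1)^-1)%R by rewrite -pp' addrC addKr invrK.
by field; rewrite p_neq0 p1_neq0.
Qed.

Lemma gap_exponentE : (r = p * q / (p - q))%R.
Proof.
rewrite -[LHS]invrK rE; field.
by rewrite p_neq0 q_neq0 pq_neq0.
Qed.

Lemma conjugate_gt0 : (0 < p')%R.
Proof. by rewrite conjugateE divr_gt0 ?subr_gt0 // (lt_trans q0 qp). Qed.

Lemma gap_exponent_gt0 : (0 < r)%R.
Proof. by rewrite gap_exponentE divr_gt0 ?mulr_gt0 ?subr_gt0 // (lt_trans q0 qp). Qed.

Ltac exponent_field :=
  rewrite ?gap_exponentE ?conjugateE; field;
  rewrite ?p_neq0 ?q_neq0 ?pq_neq0 ?p1_neq0 //.

(** With s = r/q the factor x^(s-1) of the layer-cake formula becomes the weight x^(r/p) of C_0. *)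
Lemma gap_div_q : (r / q - 1 = r / p)%R.
Proof. exponent_field. Qed.

(** On the left is the exponent of t when q t^(q-1) w(t) is raised to r/q; on the right is c - 1 for
    c = r/p'. *)
Lemma gap_div_conjugate : ((q - 1) * (r / q) = r / p' - 1)%R.
Proof. exponent_field. Qed.

Lemma hoelder_exponents : ((p / q)^-1 + (r / q)^-1 = 1)%R.
Proof. exponent_field. Qed.

(** The left side is the exponent of t in the test function. The form e - 1 with e = r/(p'q) makes
    its power of t integrate over (0, z) to z^e / e. *)
Lemma test_exponent : ((r / p' - 1) / p = r / p' / q - 1)%R.
Proof. exponent_field. Qed.

Lemma powR_mul_eq (x c d e : R) : (0 < x)%R -> (c + d = e)%R ->
  (x `^ c * x `^ d = x `^ e)%R.
Proof. by move=> x0 <-; rewrite powRD//; apply/implyP => _; rewrite gt_eqF. Qed.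

(** Here phi stands for the integral of f^p and a for [nfp_energy b]; the left side is the q-th root
    of what Hoelder's inequality yields. *)
Lemma upper_constant (a phi : R) : (0 <= a)%R -> (0 <= phi)%R ->
  (((p' `^ p * phi) `^ (p / q)^-1 *
    (q `^ (r / p) * p' * a) `^ (r / q)^-1) `^ q^-1 =
   p' `^ q^-1 * (p' `^ (r / p') * q `^ (r / p) * a) `^ r^-1 * phi `^ p^-1)%R.
Proof.
move=> a0 phi0; have p'0 := conjugate_gt0; have r0 := gap_exponent_gt0.
have powV (x c : R) : (0 <= x)%R -> (c != 0)%R -> ((x `^ c) `^ c^-1 = x)%R.
  by move=> x0 c0; rewrite -powRrM mulfV// powRr1.
rewrite [LHS]powRM ?powR_ge0// -!powRrM.
have -> : ((p / q)^-1 * q^-1 = p^-1)%R by field; rewrite p_neq0 q_neq0.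
have -> : ((r / q)^-1 * q^-1 = r^-1)%R by field; rewrite q_neq0 gt_eqF.
rewrite [X in (X * _)%R]powRM ?powR_ge0// powV ?(ltW p'0)//.
rewrite !powRM ?mulr_ge0 ?powR_ge0 ?(ltW p'0)//.
have -> : ((p' `^ (r / p')) `^ r^-1 = p' `^ p'^-1)%R.
  by rewrite -powRrM; congr (_ `^ _)%R; field; rewrite !gt_eqF.
(* The powers of p' agree because 1 + 1/r = 1/q + 1/p'. *)
have p'E : (p' * p' `^ r^-1 = p' `^ q^-1 * p' `^ p'^-1)%R.
  rewrite -{1}(powRr1 (ltW p'0)) !(powR_mul_eq p' _ _ (1 + r^-1))//.
  by rewrite rE -pp'; ring.
transitivity ((p' * p' `^ r^-1) * phi `^ p^-1 * (q `^ (r / p)) `^ r^-1 * a `^ r^-1)%R.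
  by ring.
by rewrite p'E; ring.
Qed.

(** Dividing the lower estimate (p'q/r) a^(1/q) for the image of the test function by the upper
    estimate ((p'/q) a)^(1/p) for its norm leaves (q/r) C_0. *)
Lemma lower_constant (a : R) : (0 <= a)%R ->
  (q / r * (p' `^ (r / p') * q `^ (r / p) * a) `^ r^-1 * (p' / q * a) `^ p^-1 =
   p' * q / r * a `^ q^-1)%R.
Proof.
move=> a0; have p'0 := conjugate_gt0; have r0 := gap_exponent_gt0.
rewrite !powRM ?mulr_ge0 ?powR_ge0 ?invr_ge0 ?(ltW p'0) ?(ltW q0)// -!powRrM.
have -> : (r / p' * r^-1 = p'^-1)%R by field; rewrite !gt_eqF.
have -> : (r / p * r^-1 = p^-1)%R by field; rewrite p_neq0 gt_eqF.
have aE : (a `^ r^-1 * a `^ p^-1 = a `^ q^-1)%R.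
  rewrite -powRD; first by rewrite rE subrK.
  by rewrite rE subrK invr_eq0 (negbTE q_neq0).
have p'E : (p' `^ p'^-1 * p' `^ p^-1 = p')%R.
  by rewrite (powR_mul_eq p' _ _ 1) ?powRr1 ?(ltW p'0)// addrC.
have qE : (q `^ p^-1 * q^-1 `^ p^-1 = 1)%R.
  by rewrite -powRM ?invr_ge0 ?(ltW q0)// mulfV// powR1.
transitivity (q / r * (p' `^ p'^-1 * p' `^ p^-1) * (q `^ p^-1 * q^-1 `^ p^-1) *
  (a `^ r^-1 * a `^ p^-1))%R; first by ring.
by rewrite aE p'E qE; ring.
Qed.

End exponents.

(** * Truncating a normal form parameter *)

Section truncation.
Context {R : realType}.
Variable b : R -> \bar R.
Hypothesis b_nfp : normal_form_parameter b.

(** Capped at height n and cut off to 0 from n onwards: still non-increasing, below b, and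
    increasing to b with n. *)
Definition trunc_nfp (n : nat) (x : R) : \bar R :=
  if (x < n%:R)%R then mine (b x) n%:R%:E else 0.

Lemma trunc_nfp_le n x : halfline x -> trunc_nfp n x <= b x.
Proof.
move=> Hx; rewrite /trunc_nfp; case: ifP => _; last exact: nfp_ge0.
by rewrite ge_min lexx.
Qed.

Lemma trunc_nfp_le_nat n x : trunc_nfp n x <= n%:R%:E.
Proof. by rewrite /trunc_nfp; case: ifP => _; rewrite ?lee_fin// ge_min lexx orbT. Qed.

Lemma trunc_nfp_ge0 n x : halfline x -> 0 <= trunc_nfp n x.
Proof.
by move=> Hx; rewrite /trunc_nfp; case: ifP => // _; rewrite le_min nfp_ge0//= lee_fin.
Qed.

Lemma normal_form_trunc n : normal_form_parameter (trunc_nfp n).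
Proof.
split=> [x|x y]; first exact: trunc_nfp_ge0.
move=> Hx Hy xy; rewrite {1}/trunc_nfp; case: ifPn => yn; last exact: trunc_nfp_ge0.
rewrite /trunc_nfp (le_lt_trans xy yn) le_min !ge_min lexx orbT andbT.
by apply/orP; left; apply: nfp_le => //; rewrite -halflineE.
Qed.

Lemma trunc_nfp_nd x : halfline x -> nondecreasing_seq (trunc_nfp ^~ x).
Proof.
move=> Hx m n mn; have mnR : (m%:R <= n%:R :> R)%R by rewrite ler_nat.
rewrite {1}/trunc_nfp; case: ifPn => xm; last exact: trunc_nfp_ge0.
by rewrite /trunc_nfp (lt_le_trans xm mnR) le_min !ge_min lexx lee_fin mnR orbT.
Qed.

Lemma ereal_sup_trunc_nfp (c d : R) x : (0 < c)%R -> (0 < d)%R -> halfline x ->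
  ereal_sup (range (fun n => d%:E * trunc_nfp n x `^ c)) = d%:E * b x `^ c.
Proof.
move=> c0 d0 Hx; apply/eqP; rewrite eq_le; apply/andP; split.
  apply: ge_ereal_sup => _ [n _ <-]; rewrite lee_pmul2l ?lte_fin//.
  apply: le_poweR; [exact: ltW|exact: trunc_nfp_ge0|exact: trunc_nfp_le].
have bx0 : 0 <= b x by exact: nfp_ge0.
have [n0 xn0] : exists n : nat, (x < n%:R)%R.
  by exists (Num.bound x); rewrite archi_boundP// ltW//; move: Hx; rewrite halflineE.
case bxE : (b x) bx0 => [B| |//] bx0.
  (* Beyond both x and B, the truncation agrees with b at x, so the supremum is attained. *)
  pose n := maxn n0 (Num.bound B).
  have Bn : (B < n%:R)%R.
    by apply: lt_le_trans (archi_boundP bx0) _; rewrite ler_nat leq_maxr.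
  have xn : (x < n%:R)%R by apply: lt_le_trans xn0 _; rewrite ler_nat leq_maxl.
  apply: ereal_sup_ubound; exists n => //=.
  by rewrite /trunc_nfp xn bxE min_l// lee_fin ltW.
rewrite poweRyr ?gt_eqF// gt0_muley ?lte_fin// leye_eq; apply/eqP/eqyP => A A0.
have dA : (0 <= (A / d) `^ c^-1)%R by exact: powR_ge0.
(* Where b(x) = +oo the truncation equals n, and this n gives d n^c >= A. *)
pose n := maxn n0 (Num.bound ((A / d) `^ c^-1)%R).
have An : ((A / d) `^ c^-1 <= n%:R)%R.
  by apply/ltW/(lt_le_trans (archi_boundP dA)); rewrite ler_nat leq_maxr.
have xn : (x < n%:R)%R by apply: lt_le_trans xn0 _; rewrite ler_nat leq_maxl.
apply: (@le_trans _ _ (d%:E * trunc_nfp n x `^ c)); last by apply: ereal_sup_ubound; exists n.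
rewrite /trunc_nfp xn bxE min_r ?leey// poweR_EFin -EFinM lee_fin.
rewrite -ler_pdivrMl// mulrC.
have -> : (A / d = ((A / d) `^ c^-1) `^ c)%R.
  by rewrite -powRrM mulVf ?gt_eqF// powRr1// divr_ge0// ltW.
by rewrite ge0_ler_powR ?nnegrE// ltW.
Qed.

End truncation.

(** * The two bounds *)

Section bounds.
Context {R : realType}.
Local Notation mu := (@completed_lebesgue_measure R).
Local Notation H := (halfline : set (lebesgueType R)).
Variables p q r p' : R.
Hypotheses (q0 : (0 < q)%R) (qp : (q < p)%R) (p1 : (1 < p)%R).
Hypotheses (pp' : (p^-1 + p'^-1 = 1)%R) (rE : (r^-1 = q^-1 - p^-1)%R).

Let p0 : (0 < p)%R. Proof. exact: lt_trans qp. Qed.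
Let r0 : (0 < r)%R. Proof. exact: (gap_exponent_gt0 p q r). Qed.
Let p'0 : (0 < p')%R. Proof. exact: (conjugate_gt0 p q p'). Qed.
Let rp'0 : (0 < r / p')%R. Proof. exact: divr_gt0. Qed.
Let rq0 : (0 < r / q)%R. Proof. exact: divr_gt0. Qed.
Let pq0 : (0 < p / q)%R. Proof. exact: divr_gt0. Qed.

(** This is C_0^r without its constant factor p'^(r/p') q^(r/p). *)
Definition nfp_energy (b : R -> \bar R) : \bar R :=
  \int[mu]_(x in H) ((x `^ (r / p))%:E * b x `^ (r / p')).

Lemma nfp_energy_ge0 b : 0 <= nfp_energy b.
Proof.
by apply: integral_ge0 => x _; rewrite mule_ge0 ?poweR_ge0// lee_fin powR_ge0.
Qed.

Lemma measurable_nfp_energy b : normal_form_parameter b ->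
  measurable_fun H (fun x => (x `^ (r / p))%:E * b x `^ (r / p')).
Proof.
move=> bn; apply: emeasurable_funM; last exact/measurable_poweR_fun/measurable_nfp.
have := measurable_powR_halfline 1 (r / p) : measurable_fun H _.
by apply: eq_measurable_fun => x _; rewrite mul1r.
Qed.

Lemma integral_energyE b : normal_form_parameter b ->
  \int[mu]_(x in H) ((p'%:E * b x) `^ (r / p') * (q * x)%:E `^ (r / p)) =
  (p' `^ (r / p') * q `^ (r / p))%:E * nfp_energy b.
Proof.
move=> bn; rewrite -ge0_integralZl.
- apply: eq_integral => x /set_mem Hx; have := Hx; rewrite halflineE => x0.
  rewrite poweRM ?lee_fin ?(ltW p'0) ?nfp_ge0// !poweR_EFin powRM ?(ltW q0) ?(ltW x0)//.
  by rewrite !EFinM -!muleA; congr (_ * _); rewrite muleCA [b x `^ _ * _]muleC.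
- exact: measurable_halfline.
- exact: measurable_nfp_energy.
- by move=> x _; rewrite mule_ge0 ?poweR_ge0// lee_fin powR_ge0.
- by rewrite lee_fin mulr_ge0 ?powR_ge0.
Qed.

(** The case c = r/p', s = r/q of [level_measure_integral], divided by c; the constant is s/c =
    p'/q. It controls the weight in the upper bound and the norm of the test function in the lower
    one. *)
Lemma level_measure_energy (b : R -> \bar R) : normal_form_parameter b ->
  \int[mu]_(t in H) ((t `^ (r / p' - 1))%:E * level_measure b t `^ (r / q)) <=
  (p' / q)%:E * nfp_energy b.
Proof.
move=> bn; rewrite -[leRHS]mul1e.
have mpow (c : R) : measurable_fun H (fun t : R => (t `^ c)%:E).
  have := measurable_powR_halfline 1 c : measurable_fun H _.
  by apply: eq_measurable_fun => x _; rewrite mul1r.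
have := level_measure_integral b bn _ _ rp'0 rq0.
under eq_integral do rewrite EFinM -muleA.
rewrite ge0_integralZl; first last.
- by rewrite lee_fin ltW.
- by move=> t _; rewrite mule_ge0 ?poweR_ge0// lee_fin powR_ge0.
- apply: emeasurable_funM; first exact: mpow.
  exact/measurable_poweR_fun/measurable_level_measure.
- exact: measurable_halfline.
under [leRHS]eq_integral do rewrite EFinM -muleA (gap_div_q p q r)//.
rewrite ge0_integralZl; first last.
- by rewrite lee_fin ltW.
- by move=> t _; rewrite mule_ge0 ?poweR_ge0// lee_fin powR_ge0.
- exact: measurable_nfp_energy.
- exact: measurable_halfline.
rewrite -lee_pdivlMl// muleA -EFinM mul1e.
by have -> : ((r / p')^-1 * (r / q) = p' / q)%R by field; rewrite !gt_eqF.
Qed.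

(** * The upper bound through the maximal majorant *)

Lemma integral_hardy_le b f : normal_form_parameter b ->
  (forall x, halfline x -> b x < +oo) -> Lplus f ->
  \int[mu]_(x in H) (hardy b f x `^ q) <=
  ((p' `^ p)%:E * \int[mu]_(x in H) (f x `^ p)) `^ (p / q)^-1 *
  ((q `^ (r / p) * p')%:E * nfp_energy b) `^ (r / q)^-1.
Proof.
move=> bn bfin Lf; have [mf f0] := Lf.
have [K [K0 K_ni fK KP]] := maximal_majorant f p p' p1 pp' mf f0.
have mK : measurable_fun H K by exact: measurable_nonincreasing.
have dens0 (t : R) : 0 <= (q * t `^ (q - 1))%:E.
  by rewrite lee_fin mulr_ge0 ?powR_ge0// ltW.
pose k t := (q * t `^ (q - 1))%:E * K t `^ q.
have mk : measurable_fun H k.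
  apply: emeasurable_funM; first exact: measurable_powR_halfline.
  exact: measurable_poweR_fun.
have k0 t : 0 <= k t by rewrite mule_ge0 ?poweR_ge0.
have mb := measurable_nfp b bn.
pose v t := (q * t `^ (q - 1))%:E * level_measure b t.
have mv : measurable_fun H v.
  apply: emeasurable_funM; first exact: measurable_powR_halfline.
  exact: measurable_level_measure.
have v0 t : 0 <= v t by rewrite mule_ge0 ?level_measure_ge0.
(* Integrating the pointwise bound in x and exchanging the order turns the inner integral over x
   into w(t), which [v] absorbs. *)
apply: (@le_trans _ _ (\int[mu]_(t in H) (K t `^ q * v t))).
  have <- : \int[mu]_(x in H) (cst 1 x * \int[mu]_(t in segment0 (b x)) k t) =
      \int[mu]_(t in H) (K t `^ q * v t).
    rewrite (tonelli_segment0 (cst 1) k b (measurable_cst _) mk mb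
      (fun _ _ => lee01) (fun t _ => k0 t)).
    apply: eq_integral => t _; rewrite integral_cst; last exact: measurable_superlevel.
    by rewrite mul1e /k /v muleA [K t `^ q * _]muleC.
  apply: ge0_le_integral.
  - exact: measurable_halfline.
  - by move=> x _; exact: poweR_ge0.
  - exact/measurable_poweR_fun/measurable_hardy.
  - apply: measurable_nonincreasing => x y x0 xy; rewrite !mul1e.
    apply: ge0_subset_integral.
    + exact: measurable_segment0.
    + exact: measurable_segment0.
    + by apply: measurable_funS mk; [exact: measurable_halfline|exact: segment0_sub].
    + by move=> t _; exact: k0.
    + move=> t [t0 tb]; split => //; apply: lt_le_trans tb _.
      exact: (nfp_le b bn).
  - move=> x Hx; rewrite mul1e; apply: (hardy_poweR_le b bn f K) => //.
      by rewrite -halflineE.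
    exact: bfin.
(* The exponent p/q turns K^q into K^p, to which the maximal inequality applies; r/q is its
   conjugate exponent. *)
apply: le_trans (ge0_hoelder H (fun t => K t `^ q) v (p / q) (r / q) pq0 rq0
  (hoelder_exponents p q r q0 qp rE) measurable_halfline (measurable_poweR_fun q K mK) mv
  (fun t _ => poweR_ge0 _ _) (fun t _ => v0 t)) _.
apply: lee_pmul; [exact: poweR_ge0|exact: poweR_ge0| |].
  apply: le_poweR; first by rewrite invr_ge0 ltW.
    by apply: integral_ge0 => x _; exact: poweR_ge0.
  apply: le_trans KP; rewrite le_eqVlt; apply/orP; left; apply/eqP.
  apply: eq_integral => t _; rewrite -poweRrM; congr (_ `^ _).
  by field; rewrite gt_eqF.
apply: le_poweR; first by rewrite invr_ge0 ltW.
  by apply: integral_ge0 => x _; exact: poweR_ge0.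
have -> : \int[mu]_(t in H) (v t `^ (r / q)) = (q `^ (r / q))%:E *
    \int[mu]_(t in H) ((t `^ (r / p' - 1))%:E * level_measure b t `^ (r / q)).
  rewrite -ge0_integralZl.
  - apply: eq_integral => t _; rewrite /v poweRM ?level_measure_ge0// poweR_EFin.
    rewrite powRM ?powR_ge0 ?(ltW q0)// -powRrM (gap_div_conjugate p q r p')//.
    by rewrite EFinM muleA.
  - exact: measurable_halfline.
  - apply: emeasurable_funM; last exact/measurable_poweR_fun/measurable_level_measure.
    have := measurable_powR_halfline 1 (r / p' - 1) : measurable_fun H _.
    by apply: eq_measurable_fun => x _; rewrite mul1r.
  - by move=> t _; rewrite mule_ge0 ?poweR_ge0// lee_fin powR_ge0.
  - by rewrite lee_fin powR_ge0.
(* One factor q of q^(r/q) cancels the denominator of p'/q, as r/q - 1 = r/p. *)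
have -> : (q `^ (r / p) * p' = q `^ (r / q) * (p' / q))%R.
  rewrite -(mulr_powRB1 (ltW q0) rq0) (gap_div_q p q r)//.
  by field; rewrite gt_eqF.
rewrite EFinM -muleA lee_pmul2l ?lte_fin ?powR_gt0//.
exact: level_measure_energy.
Qed.

(** If b(x) = +oo, monotonicity makes b infinite on all of (0, x), and the energy is infinite. *)
Lemma energy_fin_nfp b x : normal_form_parameter b -> nfp_energy b < +oo ->
  halfline x -> b x < +oo.
Proof.
move=> bn bE; rewrite halflineE => x0; rewrite ltey; apply/eqP => bx.
suff : nfp_energy b = +oo by move=> E; move: bE; rewrite E ltxx.
apply/eqP; rewrite -leye_eq.
apply: (@le_trans _ _ (\int[mu]_(t in segment0 x%:E) (cst +oo t))).
  rewrite integral_cst; last exact: measurable_segment0.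
  rewrite [X in _ * X](_ : _ = x%:E); last exact: (mu_segment0 _ (ltW x0)).
  by rewrite gt0_mulye ?lte_fin.
apply: (@le_trans _ _
    (\int[mu]_(t in segment0 x%:E) ((t `^ (r / p))%:E * b t `^ (r / p')))).
  rewrite le_eqVlt; apply/orP; left; apply/eqP; apply: eq_integral => t /set_mem[t0].
  rewrite lte_fin => /ltW tx; have := nfp_le b bn _ _ t0 tx; rewrite bx leye_eq => /eqP ->.
  by rewrite poweRyr ?gt_eqF// gt0_muley// lte_fin powR_gt0.
apply: ge0_subset_integral.
- exact: measurable_segment0.
- exact: measurable_halfline.
- exact: measurable_nfp_energy.
- by move=> t _; rewrite mule_ge0 ?poweR_ge0// lee_fin powR_ge0.
- exact: segment0_sub.
Qed.

Lemma hardy_norm_le b : normal_form_parameter b ->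
  hardy_norm p q b <= (p' `^ q^-1)%:E *
    ((p' `^ (r / p') * q `^ (r / p))%:E * nfp_energy b) `^ r^-1.
Proof.
move=> bn; have M0 : (0 < p' `^ (r / p') * q `^ (r / p))%R by rewrite mulr_gt0 ?powR_gt0.
(* Infinite energy makes the right-hand side infinite; finite energy makes b finite, as
   [integral_hardy_le] requires. *)
have [E|Efin] := eqVneq (nfp_energy b) +oo.
  rewrite E gt0_muley ?lte_fin// poweRyr ?invr_eq0 ?gt_eqF//.
  by rewrite gt0_muley ?leey// lte_fin powR_gt0.
have E0 := nfp_energy_ge0 b; have Ey : nfp_energy b < +oo by rewrite ltey.
apply: ereal_inf_lbound; split.
  by rewrite mule_ge0 ?poweR_ge0// lee_fin powR_ge0.
move=> f Lf; have [mf f0] := Lf.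
have h0 x : halfline x -> 0 <= hardy b f x by move=> _; exact: hardy_ge0.
rewrite !pnormE//; set Phi := \int[mu]_(x in H) (f x `^ p) => PhiP.
have Phi0 : 0 <= Phi by apply: integral_ge0 => x _; exact: poweR_ge0.
have Phiy : Phi < +oo by apply: lty_poweRy PhiP; rewrite invr_eq0 gt_eqF.
have qV : (0 <= q^-1)%R by rewrite invr_ge0 ltW.
have I0 : 0 <= \int[mu]_(x in H) (hardy b f x `^ q).
  by apply: integral_ge0 => x _; exact: poweR_ge0.
apply: le_trans (le_poweR _ _ _ qV I0 (integral_hardy_le b f bn
  (fun x => energy_fin_nfp b x bn Ey) Lf)) _.
rewrite -/Phi; move: Phi0 Phiy E0 Ey; clear PhiP.
case: Phi => [phi|//|//]; rewrite lee_fin => phi0 _.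
case: (nfp_energy b) => [a|//|//]; rewrite lee_fin => a0 _.
by rewrite le_eqVlt; apply/orP; left; apply/eqP; congr EFin;
  exact: (upper_constant p q r p').
Qed.

(** * The lower bound for finite energy, by a test function *)

Lemma hardy_norm_ge_fin b : normal_form_parameter b -> nfp_energy b < +oo ->
  (q / r)%:E * ((p' `^ (r / p') * q `^ (r / p))%:E * nfp_energy b) `^ r^-1 <=
  hardy_norm p q b.
Proof.
move=> bn Ey; have [N0 Nbound] := hardy_norm_bound b p0 q0.
have E0 := nfp_energy_ge0 b.
have [E|E_neq0] := eqVneq (nfp_energy b) 0.
  by rewrite E mule0 poweR0r ?invr_eq0 ?gt_eqF// mule0.
have mw := measurable_level_measure b bn.
have w0 t := level_measure_ge0 b t.
(* Chosen so that f^p = t^(r/p'-1) w^(r/q). This is proportional to (q t^(q-1) w)^(r/q), the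
   equality case of the Hoelder step of the upper bound with f in place of K. *)
pose f t := (t `^ ((r / p' - 1) / p))%:E * level_measure b t `^ (r / q / p).
have mpow (c : R) : measurable_fun H (fun t : R => (t `^ c)%:E).
  have := measurable_powR_halfline 1 c : measurable_fun H _.
  by apply: eq_measurable_fun => x _; rewrite mul1r.
have mf : measurable_fun H f.
  apply: emeasurable_funM; first exact: mpow.
  exact: measurable_poweR_fun.
have f0 t : 0 <= f t by rewrite mule_ge0 ?poweR_ge0// lee_fin powR_ge0.
have Lf : Lplus f by split => // x _; exact: f0.
have Phi_le : \int[mu]_(x in H) (f x `^ p) <= (p' / q)%:E * nfp_energy b.
  apply: le_trans (level_measure_energy b bn).
  rewrite le_eqVlt; apply/orP; left; apply/eqP; apply: eq_integral => t _.
  rewrite /f poweRM ?poweR_ge0 ?lee_fin ?powR_ge0// poweR_EFin -powRrM -poweRrM.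
  by congr ((_ `^ _)%:E * _ `^ _); field; rewrite ?gt_eqF.
have Phi0 : 0 <= \int[mu]_(x in H) (f x `^ p).
  by apply: integral_ge0 => x _; exact: poweR_ge0.
have pV : (0 <= p^-1)%R by rewrite invr_ge0 ltW.
have pnorm_f : pnorm p f <= ((p' / q)%:E * nfp_energy b) `^ p^-1.
  by rewrite pnormE//; exact: le_poweR.
have e0 : (0 < r / p' / q)%R by rewrite !divr_gt0.
(* On (0, b(x)) one has w(t) >= x, so f(t) >= x^(r/(qp)) t^(e-1) with e = r/(p'q); the power of t
   integrates to b(x)^e / e. *)
have hardy_ge x : (0 < x)%R ->
    ((r / p' / q)^-1 * x `^ (r / q / p))%:E * b x `^ (r / p' / q) <= hardy b f x.
  move=> x0; have bx0 : 0 <= b x by apply: (nfp_ge0 b bn); rewrite halflineE.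
  rewrite -integral_powR_segment0// -ge0_integralZl.
  - apply: ge0_le_integral.
    + exact: measurable_segment0.
    + move=> t _; rewrite -EFinM lee_fin !mulr_ge0 ?powR_ge0 ?invr_ge0// ltW//.
    + apply: emeasurable_funM; first exact: measurable_cst.
      apply: measurable_funS (measurable_powR_halfline _ _).
        exact: measurable_halfline.
      exact: segment0_sub.
    + by apply: measurable_funS mf; [exact: measurable_halfline|exact: segment0_sub].
    + move=> t [t0 tb]; rewrite /f (test_exponent p q r p')//.
      have -> : (((r / p' / q)^-1 * x `^ (r / q / p))%:E *
          ((r / p' / q) * t `^ (r / p' / q - 1))%:E =
          (t `^ (r / p' / q - 1))%:E * (x%:E `^ (r / q / p)))%E.
        by rewrite poweR_EFin -!EFinM; congr EFin; field; rewrite !gt_eqF.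
      apply: lee_pmul; [by rewrite lee_fin powR_ge0|exact: poweR_ge0|exact: lexx|].
      apply: le_poweR; first by rewrite !divr_ge0// ltW.
        by rewrite lee_fin ltW.
      exact: (le_level_measure b bn).
  - exact: measurable_segment0.
  - apply: measurable_funS (measurable_powR_halfline _ _).
      exact: measurable_halfline.
    exact: segment0_sub.
  - by move=> t _; rewrite lee_fin mulr_ge0 ?powR_ge0// ltW.
  - by rewrite lee_fin mulr_ge0 ?powR_ge0// invr_ge0 ltW.
(* The q-th power of the pointwise bound is a constant times the integrand of the energy, and 1/e =
   p'q/r. *)
have pnorm_hardy : (p' * q / r)%:E * nfp_energy b `^ q^-1 <= pnorm q (hardy b f).
  rewrite pnormE//; last by move=> x _; exact: hardy_ge0.
  have -> : (p' * q / r)%:E * nfp_energy b `^ q^-1 =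
      (((p' * q / r) `^ q)%:E * nfp_energy b) `^ q^-1.
    rewrite poweRM ?lee_fin ?powR_ge0// poweR_EFin -powRrM mulfV ?gt_eqF// powRr1//.
    by apply: ltW; rewrite divr_gt0 // mulr_gt0.
  apply: le_poweR; first by rewrite invr_ge0 ltW.
    by rewrite mule_ge0// lee_fin powR_ge0.
  rewrite -ge0_integralZl.
  - apply: ge0_le_integral.
    + exact: measurable_halfline.
    + by move=> x _; rewrite !mule_ge0 ?poweR_ge0// lee_fin powR_ge0.
    + apply: emeasurable_funM; first exact: measurable_cst.
      exact: measurable_nfp_energy.
    + exact/measurable_poweR_fun/measurable_hardy.
    + move=> x; rewrite halflineE => x0.
      have := hardy_ge x x0 => /(le_poweR _ _ _ (ltW q0)) /=.
      rewrite poweRM ?poweR_ge0 ?lee_fin ?mulr_ge0 ?powR_ge0 ?invr_ge0 ?(ltW e0)//.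
      rewrite mule_ge0 ?poweR_ge0 ?lee_fin ?mulr_ge0 ?powR_ge0 ?invr_ge0 ?(ltW e0)//.
      move=> /(_ isT); apply: le_trans.
      rewrite poweR_EFin [in leRHS]powRM ?powR_ge0 ?invr_ge0 ?(ltW e0)//.
      rewrite -powRrM -poweRrM [in leRHS]EFinM -muleA.
      have -> : (r / p' / q * q = r / p')%R by field; rewrite !gt_eqF.
      have -> : (r / q / p * q = r / p)%R by field; rewrite !gt_eqF.
      by have -> : ((r / p' / q)^-1 = p' * q / r)%R by field; rewrite !gt_eqF.
  - exact: measurable_halfline.
  - exact: measurable_nfp_energy.
  - by move=> x _; rewrite mule_ge0 ?poweR_ge0// lee_fin powR_ge0.
  - by rewrite lee_fin powR_ge0.
have pnorm_fin : pnorm p f < +oo.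
  apply: le_lt_trans pnorm_f _; apply: poweR_lty.
  by rewrite lte_mul_pinfty// lee_fin divr_ge0// ltW.
(* The two estimates are compared through the norm N, and the common factor ((p'/q) a)^(1/p),
   positive since a > 0, is cancelled. *)
have := le_trans pnorm_hardy (Nbound f Lf pnorm_fin).
move=> /le_trans /(_ (lee_wpmul2l N0 pnorm_f)).
move: E0 Ey E_neq0; case: (nfp_energy b) => [a|//|//]; rewrite lee_fin => a0 _ a_neq0.
have {a_neq0}a_gt0 : (0 < a)%R by rewrite lt0r a0 andbT; move: a_neq0; rewrite eqe.
have -> : (p' * q / r)%:E * a%:E `^ q^-1 = (q / r)%:E *
    ((p' `^ (r / p') * q `^ (r / p))%:E * a%:E) `^ r^-1 *
    ((p' / q)%:E * a%:E) `^ p^-1.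
  by congr EFin; rewrite -(lower_constant p q r p').
rewrite lee_pmul2r//.
by rewrite poweR_gt0// mule_gt0 ?lte_fin// divr_gt0.
Qed.

(** * Removing the finiteness of the energy by truncation *)

Lemma hardy_norm_mono (b c : R -> \bar R) : normal_form_parameter b ->
  normal_form_parameter c -> (forall x, halfline x -> b x <= c x) ->
  hardy_norm p q b <= hardy_norm p q c.
Proof.
move=> bn cn bc; apply: le_ereal_inf => C [C0 hC]; split => // f Lf fp.
have hb x (_ : halfline x) := hardy_ge0 b f x Lf.
have hc x (_ : halfline x) := hardy_ge0 c f x Lf.
apply: le_trans (hC f Lf fp).
rewrite (pnormE q (hardy b f) q0 hb) (pnormE q (hardy c f) q0 hc).
apply: le_poweR; first by rewrite invr_ge0 ltW.
  by apply: integral_ge0 => x _; exact: poweR_ge0.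
apply: ge0_le_integral.
- exact: measurable_halfline.
- by move=> x _; exact: poweR_ge0.
- exact/measurable_poweR_fun/measurable_hardy.
- exact/measurable_poweR_fun/measurable_hardy.
- move=> x Hx; apply: le_poweR; [exact: ltW|exact: hardy_ge0|].
  exact/le_segment0_integral/bc.
Qed.

(** The integrand is at most n^(r/p) n^(r/p') on (0, n) and zero elsewhere; the open interval
    suffices because the truncation vanishes at n. *)
Lemma trunc_energy_fin b n : normal_form_parameter b ->
  nfp_energy (trunc_nfp b n) < +oo.
Proof.
move=> bn; have n0 : (0 <= n%:R :> R)%R by [].
have rp0 : (0 < r / p)%R by rewrite divr_gt0.
pose C := ((n%:R `^ (r / p))%:E * (n%:R `^ (r / p'))%:E)%E.
have C0 : 0 <= C by rewrite mule_ge0// lee_fin powR_ge0.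
apply: (@le_lt_trans _ _ (\int[mu]_(x in segment0 n%:R%:E) (cst C x))).
  rewrite /nfp_energy integral_mkcond [leRHS]integral_mkcond; apply: ge0_le_integral.
  - exact: measurableT.
  - move=> x _; apply: erestrict_ge0 => y _.
    by rewrite mule_ge0 ?poweR_ge0// lee_fin powR_ge0.
  - apply/(measurable_restrictT _ _).1; first exact: measurable_halfline.
    exact/measurable_nfp_energy/normal_form_trunc.
  - apply/(measurable_restrictT _ _).1; first exact: measurable_segment0.
    exact: measurable_cst.
  - move=> x _; rewrite !patchE; case: ifPn => xH; last by case: ifP.
    have x0 : (0 < x)%R by move: xH; rewrite inE halflineE.
    have [xn|xn] := ltP x n%:R%R; last first.
      rewrite /trunc_nfp ltNge xn/= powR0 ?gt_eqF// mule0.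
      by case: ifP.
    rewrite mem_set; last by split.
    apply: lee_pmul; [by rewrite lee_fin powR_ge0|exact: poweR_ge0| |].
      by rewrite lee_fin ge0_ler_powR ?nnegrE// ltW.
    rewrite -poweR_EFin; apply: le_poweR; first exact: ltW.
      by apply: trunc_nfp_ge0; rewrite ?halflineE.
    exact: trunc_nfp_le_nat.
rewrite integral_cst; last exact: measurable_segment0.
rewrite [X in _ * X](_ : _ = n%:R%:E); last exact: (mu_segment0 _ n0).
by rewrite /C -!EFinM ltry.
Qed.

(** Each truncation has finite energy and, by monotonicity, a norm at most N. Monotone convergence
    carries the resulting bound over to b. *)
Lemma hardy_norm_ge b : normal_form_parameter b ->
  (q / r)%:E * ((p' `^ (r / p') * q `^ (r / p))%:E * nfp_energy b) `^ r^-1 <=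
  hardy_norm p q b.
Proof.
move=> bn; set M := (p' `^ (r / p') * q `^ (r / p))%R; set N := hardy_norm p q b.
have M0 : (0 < M)%R by rewrite mulr_gt0 ?powR_gt0.
have qr0 : (0 < q / r)%R by rewrite divr_gt0.
have N0 : 0 <= N by case: (hardy_norm_bound b p0 q0).
(* Solved for the energy, the inequality bounds an integral by a quantity independent of n, as
   passing to the supremum requires. *)
have trunc_le n : nfp_energy (trunc_nfp b n) <= M^-1%:E * ((q / r)^-1%:E * N) `^ r.
  rewrite lee_pdivlMl//.
  set E := M%:E * _; have E0 : 0 <= E by rewrite mule_ge0 ?nfp_energy_ge0// lee_fin ltW.
  have -> : E = (E `^ r^-1) `^ r by rewrite -poweRrM mulVf ?gt_eqF// poweRe1.
  apply: le_poweR; [exact: ltW|exact: poweR_ge0|].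
  rewrite lee_pdivlMl//.
  apply: le_trans (hardy_norm_ge_fin _ (normal_form_trunc b bn n) (trunc_energy_fin b n bn)) _.
  apply: hardy_norm_mono => //; first exact: normal_form_trunc.
  by move=> x Hx; exact: trunc_nfp_le.
have : nfp_energy b <= M^-1%:E * ((q / r)^-1%:E * N) `^ r.
  have <- : \int[mu]_(x in H)
      ereal_sup (range (fun n => (x `^ (r / p))%:E * trunc_nfp b n x `^ (r / p'))) =
      nfp_energy b.
    apply: eq_integral => x /set_mem Hx; apply: ereal_sup_trunc_nfp => //.
    by rewrite powR_gt0//; move: Hx; rewrite halflineE.
  apply: integral_ereal_sup_le.
  - exact: measurable_halfline.
  - by move=> n; exact/measurable_nfp_energy/normal_form_trunc.
  - by move=> n x _; rewrite mule_ge0 ?poweR_ge0// lee_fin powR_ge0.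
  - move=> x Hx m n mn; apply: lee_wpmul2l; first by rewrite lee_fin powR_ge0.
    apply: le_poweR; [exact: ltW|exact: trunc_nfp_ge0|exact: trunc_nfp_nd].
  - exact: trunc_le.
rewrite lee_pdivlMl// => ME.
rewrite -lee_pdivlMl//.
have -> : (q / r)^-1%:E * N = (((q / r)^-1%:E * N) `^ r) `^ r^-1.
  by rewrite -poweRrM mulfV ?gt_eqF// poweRe1// mule_ge0// lee_fin invr_ge0 ltW.
apply: le_poweR => //; first by rewrite invr_ge0 ltW.
by rewrite mule_ge0 ?nfp_energy_ge0// lee_fin ltW.
Qed.

End bounds.

Theorem theorem3p9 (R : realType) (p q r p' : R) (b : R -> \bar R)
    (q_gt0 : (0 < q)%R) (q_lt_p : (q < p)%R) (p_gt1 : (1 < p)%R)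
    (conj_p : (p^-1 + p'^-1 = 1)%R) (r_def : (r^-1 = q^-1 - p^-1)%R)
    (b_nfp : normal_form_parameter b) :
  let C0 := (\int[@completed_lebesgue_measure R]_(x in halfline)
      ((p'%:E * b x) `^ (r / p') * (q * x)%:E `^ (r / p))) `^ r^-1 in
  (q / r)%:E * C0 <= hardy_norm p q b /\
  hardy_norm p q b <= (p' `^ q^-1)%:E * C0.
Proof.
move=> C0; rewrite /C0 (integral_energyE p q r p')//; split.
  exact: hardy_norm_ge.
exact: hardy_norm_le.
Qed.
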